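(* Let $r, s \ge 1$ and let $f \in \mathbb{Z}[T_1, \dots, T_s, Y_1, \dots, Y_r]$ be a polynomial irreducible over $\mathbb{Q}$ of total degree $d$. Let $1 \le B_1 \leq B_2 \leq \dots \leq B_s$. Then \[ S(f, B_1, \dots, B_s) \ll_{d, r, s} B_1 \Big(\prod_{i=2}^s B_i^2\Big) (\log\|f\| + \log B_s)^5 . \]
   Context: The height of a rational number $t = x/y$ in lowest terms is $H(t)=\max(|x|,|y|)$. For a nonzero integer polynomial $f$, $\|f\|$ is the maximum of $2$ and the absolute values of its coefficients. $S(f,B_1,\dots,B_s)$ is the number of $(t_1,\dots,t_s)\in\mathbb{Q}^s$ with $H(t_i)\le B_i$ for $i=1,\dots,s$ such that $f(t_1,\dots,t_s,Y_1,\dots,Y_r)$ is reducible in $\mathbb{Q}[Y_1,\dots,Y_r]$. $U \ll_\rho V$ means $|U|\le cV$ for a positive constant $c$ depending only on $\rho$. *)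

(* Defs.v *)
From HB Require Import structures.
From mathcomp Require Import all_boot all_order all_algebra.
From mathcomp Require Import mpoly.

Set Implicit Arguments.
Unset Strict Implicit.
Unset Printing Implicit Defensive.

Import Order.TTheory GRing.Theory Num.Theory.
Local Open Scope ring_scope.

(* Polynomials with integer coefficients in n variables. The first s
   variables are T_1..T_s, the last r are Y_1..Y_r (n = s + r). *)
Definition intpoly (n : nat) := {mpoly int[n]}.

Notation point s := {ffun 'I_s -> rat}.

Definition height (x : rat) : nat := maxn `|numq x|%N `|denq x|%N.

Definition polynorm (n : nat) (f : intpoly n) : nat :=
  maxn 2 (\max_(m <- msupp f) `|f@_m|%N).

(* Total degree of f (msize f = 1 + total degree for f <> 0). *)
Definition total_degree (n : nat) (f : intpoly n) : nat := (msize f).-1.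

Definition reducible_Q (n : nat) (g : {mpoly rat[n]}) : Prop :=
  exists a b : {mpoly rat[n]}, (1 < msize a)%N /\ (1 < msize b)%N /\ g = a * b.

Definition irreducible_Q (n : nat) (g : {mpoly rat[n]}) : Prop :=
  (1 < msize g)%N /\ ~ reducible_Q g.

Definition toQ (n : nat) (f : intpoly n) : {mpoly rat[n]} :=
  map_mpoly (fun z : int => (z%:~R : rat)) f.

Definition specialize (s r : nat) (f : intpoly (s + r)) (t : point s)
  : {mpoly rat[r]} :=
  toQ f \mPo [tuple match split i with
                    | inl j => (t j)%:MP
                    | inr j => 'X_j
                    end | i < s + r].

Definition irreducible_over_Q (n : nat) (f : intpoly n) : Prop :=
  irreducible_Q (toQ f).

Definition spec_reducible (s r : nat) (f : intpoly (s + r)) (t : point s) : Prop :=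
  reducible_Q (specialize f t).

(* Main.v *)
Require Import Defs.
From mathcomp Require Import all_boot all_order all_algebra.

(* Only one specialized variable T is essential: for several variables one
   specializes t_s first, noting that the bad t_s are few by the one-variable
   case and that for good t_s induction applies to f(..., t_s, ...).

   One variable.  After a Kronecker substitution, a factorization of f(t, Y)
   is given by the coefficients z_j of two monic univariate factors, each of
   which is a root of R(t, Z), where R in Z[T][Z] is a resolvent of bounded
   degree obtained from the fundamental theorem on symmetric functions.  Every
   z_j is a simple root of some derivative S of R(t, Z).  Put L = log |f| +
   log B and choose a prime p = O(L^2) at which all data are units, and q = p^k
   just above 4B.  On a class of t modulo q (and of the z_j modulo p) Hensel's
   lemma makes z_j a p-adic analytic function of t.  The pigeonhole principle
   then gives A0, A1 in Z[T], of degree O(L) and not both zero, such that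
   A0(t) + A1(t) z_j is divisible by a power of q exceeding its size, hence
   vanishes, on the whole class.  So on a class the factors are given by
   rational functions of t of degree O(L); with more than O(L) points in the
   class f would factor over Q(T), contradicting Gauss's lemma.  There are
   O(B L^4) classes, each with O(L) points. *)

(** The relation sought is linear in z_j because it then gives z_j as one rational function of T on
    a whole class, and so turns numerical factorizations into a polynomial identity. Its degree D
    need only be O(L): for t of height at most X and z_j of height at most W, the auxiliary value
    has numerator at most 2(D+1) W q^(D+2) X^D, against divisibility by q^(2D+2). As q >= 4X, the
    inequality 2(D+1)W < 4^D suffices, and log W = O(L). The prime must avoid the denominators of t
    and z_j and the numerator of S'(t, z_j), all nonzero integers below 2^O(L); it therefore varies
    with t and belongs to the data of a class. The exponent 5 is 2 + 2 + 1: O(L^2) values of p, O(B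
    L^2) residues of t because q < 4Bp, and O(L) points per class. In several variables the largest
    bound is treated first. Bad values of t_s then contribute B_s times the squares of the smaller
    bounds, which the ordering of the bounds makes admissible; good values contribute B_s^2 times
    the inductive bound. *)

Module HilbertIrreducibility.

From HB Require Import structures.
From Stdlib Require Import Classical_Prop.
From mathcomp Require Import perm algC.
From mathcomp Require Import mpoly zify ring lra.

Set Implicit Arguments.
Unset Strict Implicit.
Unset Printing Implicit Defensive.

Import Order.TTheory GRing.Theory Num.Theory.

(** * A small prime not dividing a given integer *)

Section PrimeAvoid.

Lemma big_nat_eq0 (a b : nat) (F : nat -> nat) :
  (forall k, a <= k < b -> F k = 0) -> \sum_(a <= k < b) F k = 0.
Proof. by move=> F0; rewrite big_nat big1. Qed.

Lemma big_nat_le_trunc_log (p n : nat) (F : nat -> nat) : 1 < p -> 0 < n ->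
  (forall k, F k <= (p ^ k <= n)) -> \sum_(1 <= k < n.+1) F k <= trunc_log p n.
Proof.
move=> p1 n0 FP.
have lt_tl : trunc_log p n <= n.
  by apply: leq_trans (trunc_logP p1 n0); apply: ltnW; apply: ltn_expl.
rewrite (@big_cat_nat _ _ _ (trunc_log p n).+1) //=.
rewrite [X in _ + X]big_nat_eq0 ?addn0; last first.
  move=> k /andP[lk _]; apply/eqP; rewrite -leqn0.
  by apply: leq_trans (FP k) _; rewrite leqn0 eqb0 -ltnNge; apply: (leq_trans (trunc_log_ltn n p1)); rewrite leq_pexp2l // ltnW.
apply: (@leq_trans (\sum_(1 <= k < (trunc_log p n).+1) 1)).
  by apply: leq_sum => k _; apply: leq_trans (FP k) _; apply: leq_b1.
by rewrite sum_nat_const_nat muln1 subn1.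
Qed.

Lemma prod_seq_const (T : Type) (s : seq T) (m : nat) :
  \prod_(x <- s) m = m ^ size s.
Proof. by elim: s => [|x s IHs]; rewrite ?big_nil // big_cons IHs expnS. Qed.

(* Legendre's formula: every summand of the valuation is 0 or 1. *)
Lemma logn_central_bin_le (p n : nat) : prime p -> 0 < n ->
  p ^ logn p 'C(n.*2, n) <= n.*2.
Proof.
move=> pp n0; have p1 := prime_gt1 pp.
have n2 : 0 < n.*2 by rewrite double_gt0.
apply: leq_trans (trunc_logP p1 n2); rewrite leq_exp2l //.
have le_n : n <= n.*2 by rewrite -addnn leq_addr.
have E : logn p (n.*2)`! = logn p 'C(n.*2, n) + (logn p n`!).*2.
  rewrite -(bin_fact le_n) -addnn addnK !lognM ?muln_gt0 ?fact_gt0 ?bin_gt0 //; last by rewrite addnn.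
  by rewrite !addnn.
move: E; rewrite !logn_fact // => E.
have E2 : \sum_(1 <= k < n.+1) n %/ p ^ k = \sum_(1 <= k < n.*2.+1) n %/ p ^ k.
  rewrite [RHS](@big_cat_nat _ _ _ n.+1) //= [X in _ + X]big_nat_eq0 ?addn0 //.
  move=> k /andP[lk _]; apply: divn_small.
  by apply: (leq_trans lk); apply: ltnW; apply: ltn_expl.
have -> : logn p 'C(n.*2, n) =
    \sum_(1 <= k < n.*2.+1) ((n.*2 %/ p ^ k) - (n %/ p ^ k).*2).
  rewrite sumnB; last first.
    move=> k _; rewrite leq_divRL ?expn_gt0 ?prime_gt0 //.
    by rewrite -muln2 mulnAC muln2 leq_double leq_divM.
  rewrite E E2 -[X in _ + X]muln2 big_distrl /=.
  by rewrite [X in _ - X](eq_bigr (fun k => n %/ p ^ k * 2)) ?addnK // => k _; rewrite muln2.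
apply: big_nat_le_trunc_log => // k.
have pk : 0 < p ^ k by rewrite expn_gt0 prime_gt0.
case: (leqP (p ^ k) n.*2) => /= H; last by rewrite divn_small.
have := ltn_pmod n pk; have := divn_eq n (p ^ k); set a := n %/ _; set r := n %% _.
move=> En r_lt; rewrite leq_subLR addn1 -ltnS ltn_divLR //.
by rewrite En -!muln2; nia.
Qed.

(** If all primes dividing the central binomial coefficient divided d, there would be fewer than l
    of them, each contributing a prime power of at most 2n. For n = 8 l^2 one has 2n <= 2^(8l), so
    the coefficient would be less than 2^n, which is its elementary lower bound. *)
Lemma prime_avoid (l d : nat) : 0 < l -> 0 < d -> d < 2 ^ l ->
  exists2 p, prime p & (p <= 16 * l ^ 2) && ~~ (p %| d).
Proof.
move=> l0 d0 dl; pose n := 8 * l ^ 2.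
have n0 : 0 < n by rewrite muln_gt0 expn_gt0 l0.
case: (altP (@allP _ (fun p => p %| d) (primes 'C(n.*2, n)))) => [Pd|]; last first.
  case/allPn=> p; rewrite mem_primes => /and3P[pp c0 pc] pd; exists p => //; rewrite pd andbT.
  have lp : 0 < logn p 'C(n.*2, n) by rewrite logn_gt0 mem_primes pp c0.
  have := leq_trans (leq_pexp2l (prime_gt0 pp) lp) (logn_central_bin_le pp n0).
  by rewrite expn1 /n -muln2; lia.
exfalso; set c := 'C(n.*2, n) in Pd.
have c0 : 0 < c by rewrite bin_gt0 -addnn leq_addr.
have le_c : c <= n.*2 ^ size (primes c).
  rewrite {1}(prod_prime_decomp c0) prime_decompE big_map /=.
  rewrite -prod_seq_const big_seq [X in _ <= X]big_seq; apply: leq_prod => p.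
  by rewrite mem_primes => /and3P[pp _ _]; apply: logn_central_bin_le.
have le_d : 2 ^ size (primes c) <= d.
  have: \prod_(p <- primes c) p %| d.
    have: forall s, uniq s -> {in s, forall p, prime p} -> {in s, forall p, p %| d} ->
        \prod_(p <- s) p %| d.
      elim=> [|p s IHs] /=; first by rewrite big_nil dvd1n.
      case/andP=> ps us Hs Ds; rewrite big_cons Gauss_dvd; last first.
        rewrite coprime_sym; have : {in s, forall r, coprime r p}.
          move=> r rs; rewrite prime_coprime ?dvdn_prime2 ?Hs ?mem_head ?inE ?rs ?orbT //.
          by apply: contra ps => /eqP <-.
        elim: (s) => [|r s' IH] H; first by rewrite big_nil coprime1n.
        rewrite big_cons coprimeMl H ?mem_head // IH // => x xs.
        by apply: H; rewrite inE xs orbT.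
      rewrite Ds ?mem_head //= IHs // => x xs; [apply: Hs|apply: Ds]; by rewrite inE xs orbT.
    apply; [exact: primes_uniq| |exact: Pd].
    by move=> p; rewrite mem_primes => /andP[].
  move/(dvdn_leq d0) => H; apply: leq_trans H.
  rewrite -prod_seq_const big_seq [X in _ <= X]big_seq.
  by apply: leq_prod => p; rewrite mem_primes => /andP[pp _]; rewrite prime_gt1.
have sl : size (primes c) < l.
  by rewrite -(ltn_exp2l _ _ (ltnSn 1)); apply: leq_ltn_trans dl.
have c2 : 2 ^ n <= c.
  rewrite /c; elim: (n) => // m IH; rewrite doubleS binS.
  have -> : 'C(m.*2.+1, m.+1) = 'C(m.*2.+1, m).
    by rewrite -bin_sub; [congr binomial; rewrite -addnn; lia|rewrite -addnn; lia].
  rewrite addnn -muln2 mulnC expnS leq_mul2l /=.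
  by case: m IH => // m IH; rewrite binS; apply: (leq_trans IH); rewrite leq_addr.
have : 2 ^ n < 2 ^ (8 * l * l).
  apply: leq_ltn_trans c2 _; apply: leq_ltn_trans le_c _.
  have l16 : n.*2 <= 2 ^ (8 * l).
    have lx : l < 2 ^ l by apply: ltn_expl.
    rewrite [8 * l](_ : _ = 6 * l + l + l); last by lia.
    rewrite (expnD _ (6 * l + l)) (expnD _ (6 * l)) /n.
    have : 16 <= 2 ^ (6 * l) by apply: (@leq_pexp2l 2 4) => //; lia.
    move=> hy; rewrite -muln2 -mulnn (_ : 8 * (l * l) * 2 = 16 * l * l); last by lia.
    by apply: leq_mul; [apply: leq_mul => //|]; apply: ltnW.
  apply: (@leq_ltn_trans ((2 ^ (8 * l)) ^ size (primes c))); first by case: (size _) => // e; rewrite leq_exp2r.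
  by rewrite -expnM ltn_exp2l // ltn_pmul2l // muln_gt0.
by rewrite ltn_exp2l // /n; nia.
Qed.

End PrimeAvoid.

Local Open Scope ring_scope.

(** * p-adic approximation *)

Definition evT (t : rat) : {poly int} -> rat :=
  horner_eval t \o map_poly intr.
HB.instance Definition _ t := GRing.RMorphism.on (evT t).

Lemma evTE t (P : {poly int}) : evT t P = (map_poly intr P).[t].
Proof. by []. Qed.

Lemma evTC t (c : int) : evT t c%:P = c%:~R.
Proof. by rewrite evTE map_polyC hornerC. Qed.

Lemma evT_horner t (S : {poly {poly int}}) (Z : {poly int}) :
  evT t S.[Z] = (map_poly (evT t) S).[evT t Z].
Proof. by rewrite horner_map. Qed.

Section Padic.
Variable p : nat.
Hypothesis pp : prime p.

(* r lies in p^k Z_(p) *)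
Definition padic (k : nat) (r : rat) : Prop :=
  exists n m : int, ~~ (p %| `|m|)%N /\ r * m%:~R = (n * (p ^ k)%N%:Z)%:~R.

Lemma pndvdM (m n : int) : ~~ (p %| `|m|)%N -> ~~ (p %| `|n|)%N ->
  ~~ (p %| `|(m * n)%R|)%N.
Proof. by rewrite abszM Euclid_dvdM // => /negbTE-> /negbTE->. Qed.

Lemma padicD k r s : padic k r -> padic k s -> padic k (r + s).
Proof.
move=> [n [m [pm E]]] [n' [m' [pm' E']]].
exists (n * m' + n' * m), (m * m'); split; first exact: pndvdM.
have -> : (r + s) * (m * m')%:~R = r * m%:~R * m'%:~R + s * m'%:~R * m%:~R.
  by rewrite intrM; ring.
by rewrite E E' -!intrM -intrD; congr (_ %:~R); ring.
Qed.

Lemma padicN k r : padic k r -> padic k (- r).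
Proof.
by move=> [n [m [pm E]]]; exists (- n), m; split=> //; rewrite mulNr E mulNr intrN.
Qed.

Lemma padicB k r s : padic k r -> padic k s -> padic k (r - s).
Proof. by move=> Hr Hs; apply: padicD => //; apply: padicN. Qed.

Lemma padicM j k r s : padic j r -> padic k s -> padic (j + k) (r * s).
Proof.
move=> [n [m [pm E]]] [n' [m' [pm' E']]].
exists (n * n'), (m * m'); split; first exact: pndvdM.
rewrite intrM mulrACA E E' -intrM expnD PoszM; congr (_ %:~R); ring.
Qed.

Lemma padicW j k r : (k <= j)%N -> padic j r -> padic k r.
Proof.
move=> kj [n [m [pm E]]]; exists (n * (p ^ (j - k))%N%:Z), m; split=> //.
by rewrite E -mulrA -PoszM -expnD subnK.
Qed.

Lemma padic_int (n : int) : padic 0 n%:~R.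
Proof.
exists n, 1; split; last by rewrite expn0 -intrM.
by rewrite absz1 dvdn1 neq_ltn prime_gt1 ?orbT.
Qed.

Lemma padic0 k : padic k 0.
Proof.
exists 0, 1; split; last by rewrite !mul0r.
by rewrite absz1 dvdn1 neq_ltn prime_gt1 ?orbT.
Qed.

Lemma padic_intP k (n : int) : padic k n%:~R <-> (p ^ k %| `|n|)%N.
Proof.
split=> [[n' [m [pm /eqP]]]|/dvdnP[c Ec]].
  rewrite -intrM eqr_int => /eqP/(congr1 absz); rewrite !abszM /= => E.
  have : (p ^ k %| `|n| * `|m|)%N by rewrite E dvdn_mull.
  by rewrite Gauss_dvdl // coprimeXl // prime_coprime.
exists (sgz n * c), 1; split.
  by rewrite absz1 dvdn1 neq_ltn prime_gt1 ?orbT.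
by rewrite mulr1 -mulrA -PoszM -Ec [in LHS](intEsg n).
Qed.

Lemma padicX k r e : padic k r -> padic (k * e) (r ^+ e).
Proof.
move=> Hr; elim: e => [|e IHe]; first by rewrite muln0; apply: (padic_int 1).
by rewrite exprS mulnS; apply: padicM.
Qed.

Lemma padic_sum k (I : Type) (s : seq I) (P : pred I) (F : I -> rat) :
  (forall i, P i -> padic k (F i)) -> padic k (\sum_(i <- s | P i) F i).
Proof.
by move=> H; elim/big_ind: _ => //; [apply: padic0|move=> *; apply: padicD].
Qed.

Lemma padic_mull k r s : padic 0 r -> padic k s -> padic k (r * s).
Proof. by move=> Hr; rewrite -{2}[k]add0n; apply: padicM. Qed.

Definition pintegral (P : {poly rat}) := forall i, padic 0 P`_i.

Lemma pintegralMX (P : {poly rat}) c :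
  pintegral (P * 'X + c%:P) -> pintegral P /\ padic 0 c.
Proof.
move=> H; split=> [i|]; first by have := H i.+1; rewrite coefD coefMX coefC /= addr0.
by have := H 0%N; rewrite coefD coefMX coefC /= add0r.
Qed.

Lemma padic_horner (P : {poly rat}) z : pintegral P -> padic 0 z -> padic 0 P.[z].
Proof.
move=> HP Hz; rewrite horner_coef; apply: padic_sum => i _.
by apply: padic_mull => //; have := padicX i Hz.
Qed.

(** The remainder is built along Horner's scheme, so nothing is divided by a factorial and p = 2 is
    no exception. *)
Lemma padic_taylor2 (P : {poly rat}) z h : pintegral P -> padic 0 z -> padic 0 h ->
  padic 0 P^`().[z] /\
  exists2 c, padic 0 c & P.[z + h] = P.[z] + P^`().[z] * h + c * h ^+ 2.
Proof.
move=> + Hz Hh; elim/poly_ind: P => [_|P c IHP /pintegralMX[HP Hc]].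
  rewrite deriv0 !horner0; split; first exact: padic0.
  by exists 0; [apply: padic0|ring].
have [dP [k Hk E]] := IHP HP.
have E' : (P * 'X + c%:P)^`().[z] = P^`().[z] * z + P.[z].
  by rewrite derivD derivM derivX derivC addr0 mulr1 !hornerE.
split; first by rewrite E'; apply: padicD; [apply: padic_mull|apply: padic_horner].
exists (k * (z + h) + P^`().[z]).
  by apply: padicD => //; apply: padic_mull => //; apply: padicD.
by rewrite E' !(hornerD, hornerM, hornerX, hornerC) E; ring.
Qed.

Lemma padic_horner_sub k (P : {poly rat}) z z' : pintegral P -> padic 0 z ->
  padic k (z' - z) -> padic k (P.[z'] - P.[z]).
Proof.
move=> HP Hz H; have H0 := padicW (leq0n k) H.
have [dP [c Hc E]] := padic_taylor2 HP Hz H0.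
move: E; rewrite addrC subrK => ->.
rewrite addrC addrA addKr expr2 mulrA -mulrDl; apply: padic_mull => //.
by apply: padicD => //; apply: padic_mull.
Qed.

Lemma pintegral_evT t (S : {poly {poly int}}) : padic 0 t ->
  pintegral (map_poly (evT t) S).
Proof.
move=> Ht i; rewrite coef_map /= evTE; apply: padic_horner => // j.
by rewrite coef_map; apply: padic_int.
Qed.

Lemma padic_evT_sub k t t' (P : {poly int}) : padic 0 t -> padic k (t' - t) ->
  padic k (evT t' P - evT t P).
Proof.
by move=> Ht H; rewrite !evTE; apply: padic_horner_sub => // i; rewrite coef_map; apply: padic_int.
Qed.

(* Newton's iteration with a fixed multiplier u, an inverse of the derivative modulo p. *)
Definition newton (S : {poly {poly int}}) (u b : int) (j : nat) : {poly int} :=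
  iter j (fun Z => Z - u%:P * S.[Z]) b%:P.

(** The error h becomes (1 - u S'(z)) h up to sign, plus a multiple of h^2, so each step gains one
    digit. Keeping u fixed gives up quadratic convergence, but the iterates are integer polynomials
    in T that depend only on the class and approximate every z in it. *)
Lemma newton_padic (S : {poly {poly int}}) (u b : int) (t z : rat) :
    padic 0 t -> padic 0 z -> padic 1 (z - b%:~R) ->
    (map_poly (evT t) S).[z] = 0 ->
    padic 1 (1 - u%:~R * (map_poly (evT t) S)^`().[z]) ->
  forall j, padic j.+1 (z - evT t (newton S u b j)).
Proof.
move=> Ht Hz Hb S0 Hu; elim=> [|j IHj]; first by rewrite /= evTC.
rewrite [newton _ _ _ _]/= -/(newton S u b j) rmorphB rmorphM /= evTC.
rewrite evT_horner; set y := evT t _ in IHj *.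
have Hh : padic j.+1 (y - z) by rewrite -opprB; apply: padicN.
have [dP [c Hc E]] := padic_taylor2 (pintegral_evT S Ht) Hz (padicW (leq0n _) Hh).
move: E; rewrite addrC subrK S0 add0r => ->.
set dS := _^`().[z]; set h := y - z.
have -> : z - (y - u%:~R * (dS * h + c * h ^+ 2)) =
   - ((1 - u%:~R * dS) * h) + u%:~R * (c * h ^+ 2) by rewrite /h; ring.
apply: padicD; first by apply: padicN; rewrite -add1n; apply: padicM.
apply: padic_mull; first exact: padic_int.
apply: padic_mull => //; have := padicX 2 Hh; apply: padicW; lia.
Qed.

End Padic.

(* In the expansion at T = a + q U the coefficient of U^e has to be divisible by
   q^(E - e), where E = 2 (D + 1): this is q^(E (E + 1) / 2) classes against
   E free coefficients in [0, q^(D + 2)]. *)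
Lemma siegel_pair (q D : nat) (a : int) (Z : {poly int}) : (0 < q)%N ->
  exists A0 A1 : {poly int},
    [/\ (A0 != 0) || (A1 != 0), (size A0 <= D.+1)%N, (size A1 <= D.+1)%N,
      (forall i, (`|(A0`_i)%R| <= q ^ D.+2)%N /\ (`|(A1`_i)%R| <= q ^ D.+2)%N)
    & forall e, (e < D.+1.*2)%N ->
        (q ^ (D.+1.*2 - e) %| `|(((A0 + A1 * Z) \Po ('X + a%:P))`_e)%R|)%N ].
Proof.
move=> q0; set E := D.+1.*2; pose h := (q ^ D.+2)%N.
pose T := {ffun 'I_D.+1 -> 'I_h.+1}.
pose pol (c : T) : {poly int} := \poly_(i < D.+1) (c (inord i))%:Z.
pose G (c : T * T) := (pol c.1 + pol c.2 * Z) \Po ('X + a%:P).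
pose M := (q ^ E)%N.
pose g (c : T * T) : {ffun 'I_E -> 'I_M.+1} :=
  [ffun e : 'I_E => inord `|((G c)`_e %% (q ^ (E - e))%N%:Z)%Z|].
have rem_lt (x : int) e : (`|(x %% (q ^ (E - e))%N%:Z)%Z| < q ^ (E - e))%N.
  have q1 : (0 < q ^ (E - e))%N by rewrite expn_gt0 q0.
  rewrite -ltz_nat gez0_abs ?modz_ge0 ?ltz_pmod //; lia.
have rem_lt' (x : int) e : (`|(x %% (q ^ (E - e))%N%:Z)%Z| < M.+1)%N.
  apply: leq_trans (rem_lt x e) _; apply: leqW; rewrite /M; apply: leq_pexp2l => //.
  exact: leq_subr.
have [/injectiveP inj_g|/injectivePn[c [c' neq_c Eg]]] := boolP (injectiveb g).
  pose F (e : 'I_E) : pred 'I_M.+1 := [pred x : 'I_M.+1 | (x < q ^ (E - e))%N].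
  have sub : (#|{: T * T}| <= #|family F|)%N.
    rewrite -(card_codom inj_g); apply: subset_leq_card; apply/subsetP => x.
    case/codomP=> c ->; apply/familyP => e; rewrite ffunE inE.
    by rewrite inordK.
  have cardF : #|family F| = (\prod_(e < E) q ^ (E - e))%N.
    rewrite card_family foldrE big_map big_enum /=.
    apply: eq_bigr => e _; rewrite (@eq_card _ _ (fun x : 'I_M.+1 => (x < q ^ (E - e))%N)) //.
    rewrite -sum1_card.
    rewrite -(big_ord_widen_cond _ xpredT (fun=> 1%N)) ?sum1_card ?card_ord //.
    by apply: leqW; apply: leq_pexp2l => //; apply: leq_subr.
  exfalso; move: sub; rewrite cardF card_prod !card_ffun !card_ord.
  rewrite -expnD addnn -/E -expn_sum.
  have -> : (\sum_(e < E) (E - e) = D.+1 * E.+1)%N.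
    have : (\sum_(e < E) (E - e) = 'C(E.+1, 2))%N.
      rewrite -triangular_sum big_mkord big_ord_recl add0n.
      rewrite (reindex_inj rev_ord_inj) /=; apply: eq_bigr => i _.
      by rewrite /bump /=; have := ltn_ord i; lia.
    by move=> ->; rewrite bin2 /= /E -muln2; nia.
  (* Each coefficient takes h + 1 values and h^E is already at least the number of residue vectors;
     the extra value makes the pigeonhole inequality strict. *)
  rewrite leqNgt => /negP[]; apply: leq_ltn_trans (_ : h ^ E < _)%N; last by rewrite ltn_exp2r.
  rewrite /h -expnM; apply: leq_pexp2l => //; rewrite /E -muln2; nia.
exists (pol c.1 - pol c'.1), (pol c.2 - pol c'.2).
have coef_pol (x : T) (i : 'I_D.+1) : (pol x)`_i = (x i)%:Z.
  by rewrite coef_poly ltn_ord inord_val.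
have pol_inj : injective pol.
  move=> x y Exy; apply/ffunP => i; apply: val_inj; apply/eqP.
  by rewrite -eqz_nat -!coef_pol Exy.
have pol_bd (x y : T) i : (`|((pol x - pol y)`_i)%R| <= h)%N.
  rewrite coefB !coef_poly; case: ifP => // _.
  have := ltn_ord (x (inord i)); have := ltn_ord (y (inord i)); lia.
have pol_sz (x y : T) : (size (pol x - pol y)%R <= D.+1)%N.
  apply: leq_trans (size_polyD _ _) _; rewrite size_polyN geq_max !size_poly //.
split=> //; first by apply: contraR neq_c; rewrite negb_or !negbK !subr_eq0 => /andP[/eqP/pol_inj E1 /eqP/pol_inj E2]; apply/eqP; rewrite [c]surjective_pairing E1 E2 -surjective_pairing.
move=> e lt_e; have := congr1 (fun f : {ffun _} => f (Ordinal lt_e)) Eg.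
rewrite !ffunE /= => /(congr1 val) /=; rewrite !inordK //.
have -> : (pol c.1 - pol c'.1 + (pol c.2 - pol c'.2) * Z) \Po ('X + a%:P) = G c - G c'.
  by rewrite /G -comp_polyB; congr (_ \Po _); ring.
move=> Er; rewrite coefB -(dvdzE (_ : nat)%:Z) -eqz_mod_dvd.
have q1 : (q ^ (E - e))%N%:Z != 0 by rewrite eqz_nat -lt0n expn_gt0 q0.
by apply/eqP; rewrite -[LHS]gez0_abs ?modz_ge0 // Er gez0_abs ?modz_ge0.
Qed.

(** * Heights and clearing of denominators *)

Lemma evT_sum (P : {poly int}) d t : (size P <= d.+1)%N ->
  evT t P = \sum_(i < d.+1) (P`_i)%:~R * t ^+ i.
Proof.
move=> sP; rewrite evTE (@horner_coef_wide _ d.+1); last first.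
  by apply: leq_trans (size_poly _ _) sP.
by apply: eq_bigr => i _; rewrite coef_map.
Qed.

Lemma height_num t X : (height t <= X)%N -> (`|numq t| <= X)%N.
Proof. by rewrite /height geq_max => /andP[]. Qed.

Lemma height_den t X : (height t <= X)%N -> (`|denq t| <= X)%N.
Proof. by rewrite /height geq_max => /andP[]. Qed.

Lemma denq_neq0Q t : (denq t)%:~R != 0 :> rat.
Proof. by rewrite intr_eq0 denq_neq0. Qed.

Lemma rat_clear t d i : (i <= d)%N ->
  t ^+ i * (denq t)%:~R ^+ d = (numq t ^+ i * denq t ^+ (d - i))%:~R.
Proof.
move=> le_id; rewrite -{1}(divq_num_den t) expr_div_n intrM !rmorphXn /=.
have -> : (denq t)%:~R ^+ d = (denq t)%:~R ^+ i * (denq t)%:~R ^+ (d - i) :> rat.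
  by rewrite -exprD subnKC.
field.
by rewrite -rmorphXn /= intr_eq0 expf_neq0 // denq_neq0.
Qed.

Lemma leq_abszD (x y : int) : (`|(x + y)%R| <= `|x| + `|y|)%N.
Proof. lia. Qed.

Lemma absz_sum (I : Type) (s : seq I) (F : I -> int) :
  (`|(\sum_(i <- s) F i)%R| <= \sum_(i <- s) `|F i|)%N.
Proof.
elim: s => [|i s IHs]; first by rewrite !big_nil.
rewrite !big_cons; by apply: leq_trans (leq_abszD _ _) _; rewrite leq_add2l.
Qed.

Lemma leq_exp2r_any m n e : (m <= n)%N -> (m ^ e <= n ^ e)%N.
Proof. by case: e => // e; rewrite leq_exp2r. Qed.

(** Provides the size side of the comparison with divisibility: an integer within this bound and
    divisible by a larger power must be 0. It also bounds the integers that the prime has to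
    avoid. *)
Lemma bihomogenize (S : {poly {poly int}}) d1 d2 H X W t z :
    (size S <= d2.+1)%N -> (forall k, size (S`_k)%R <= d1.+1)%N ->
    (forall k i, `|(S`_k`_i)%R| <= H)%N -> (height t <= X)%N -> (height z <= W)%N ->
  exists N : int, [/\
    (map_poly (evT t) S).[z] * ((denq t)%:~R ^+ d1 * (denq z)%:~R ^+ d2) = N%:~R
    & (`|N| <= d1.+1 * d2.+1 * (H * X ^ d1 * W ^ d2))%N].
Proof.
move=> sS sSk HS tX zW.
exists (\sum_(k < d2.+1) \sum_(i < d1.+1) S`_k`_i * (numq t ^+ i * denq t ^+ (d1 - i)) *
    (numq z ^+ k * denq z ^+ (d2 - k))); split.
  rewrite (@horner_coef_wide _ d2.+1); last by apply: leq_trans (size_poly _ _) sS.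
  rewrite mulr_suml rmorph_sum; apply: eq_bigr => k _; rewrite coef_map /=.
  rewrite (evT_sum t (sSk k)) !mulr_suml rmorph_sum; apply: eq_bigr => i _ /=.
  rewrite intrM [X in _ = X * _]intrM.
  have id1 : (i <= d1)%N by rewrite -ltnS.
  have kd2 : (k <= d2)%N by rewrite -ltnS.
  by rewrite -(rat_clear t id1) -(rat_clear z kd2); ring.
apply: leq_trans (absz_sum _ _) _.
have -> : (d1.+1 * d2.+1 * (H * X ^ d1 * W ^ d2) =
   \sum_(k < d2.+1) \sum_(i < d1.+1) (H * X ^ d1 * W ^ d2))%N.
  by rewrite !sum_nat_const !card_ord; ring.
apply: leq_sum => k _; apply: leq_trans (absz_sum _ _) _.
have pw m c e i : (i <= e)%N -> (height c <= m)%N ->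
   (`|(numq c ^+ i * denq c ^+ (e - i))%R| <= m ^ e)%N.
  move=> ie hc; rewrite abszM !abszX -{2}(subnKC ie) expnD.
  by apply: leq_mul; apply: leq_exp2r_any; [apply: height_num|apply: height_den].
apply: leq_sum => i _; rewrite abszM [X in (X * _ <= _)%N]abszM.
apply: leq_mul; [apply: leq_mul => //|]; apply: pw => //; by rewrite -ltnS.
Qed.

Lemma padic_denq p t : prime p -> ~~ (p %| `|denq t|)%N -> padic p 0 t.
Proof.
move=> pp pt; exists (numq t), (denq t); split=> //.
by rewrite expn0 mulr1 -[X in X * _](divq_num_den t) divfK // denq_neq0Q.
Qed.

(** A class knows z only modulo p: the further digits of z are recovered from t by Newton's
    iteration. The pair [A0], [A1] is chosen before t and z, so it serves the whole class. *)
Lemma class_relation (p k D X W : nat) (S : {poly {poly int}}) (a b : int) :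
    prime p -> (0 < k)%N -> (0 < X)%N -> (4 * X <= p ^ k)%N ->
    (D.+1 * 2 * W < 4 ^ D)%N ->
  exists A0 A1 : {poly int},
    [/\ (A0 != 0) || (A1 != 0), (size A0 <= D.+1)%N, (size A1 <= D.+1)%N
    & forall t z, (height t <= X)%N -> (height z <= W)%N ->
        ~~ (p %| `|denq t|)%N -> ~~ (p %| `|denq z|)%N ->
        (map_poly (evT t) S).[z] = 0 ->
        padic p k (t - a%:~R) -> padic p 1 (z - b%:~R) ->
        ~ padic p 1 (map_poly (evT t) S^`()).[z] ->
        evT t A0 + evT t A1 * z = 0].
Proof.
move=> pp k0 X0 Xq hD; pose s0 := (S^`().[b%:P]).[a].
(* The derivative is constant modulo p on the class, so the single integer [s0] decides whether z is
   a simple root modulo p. *)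
have close t z : padic p 0 t -> padic p 0 z -> padic p k (t - a%:~R) -> padic p 1 (z - b%:~R) ->
    padic p 1 ((map_poly (evT t) S^`()).[z] - s0%:~R).
  move=> Ht Hz Ha Hb.
  rewrite -[_ - _](subrKA (evT t S^`().[b%:P])); apply: padicD => //.
    rewrite evT_horner evTC; apply: padic_horner_sub => //.
    - exact: pintegral_evT.
    - exact: padic_int.
  have -> : s0%:~R = evT a%:~R S^`().[b%:P] by rewrite evTE horner_map.
  by apply: padic_evT_sub => //; [apply: padic_int|apply: padicW Ha].
(* If p divides [s0], no point of the class satisfies the simplicity hypothesis, and the pair 1, 0
   works vacuously. *)
have [p_s0|p_s0] := boolP (p %| `|s0|)%N.
  exists 1, 0; split; rewrite ?oner_eq0 ?size_poly1 ?size_poly0 //.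
  move=> t z tX zW pt pz S0 Ha Hb []; rewrite -[X in padic _ _ X](subrK s0%:~R).
  apply: padicD => //; first by apply: close => //; apply: padic_denq.
  by apply/padic_intP.
have [u Hu] : exists u : int, padic p 1 (1 - u%:~R * s0%:~R).
  have : coprimez s0 p by rewrite /coprimez /gcdz eqz_nat -/(coprime _ _) coprime_sym prime_coprime.
  case/coprimezP=> [[u v] /= E]; exists u; rewrite -intrM -[1]/(1%:~R) -intrB -E addrAC subrr add0r.
  by apply/padic_intP => //; rewrite abszM dvdn_mull.
have q0 : (0 < p ^ k)%N by rewrite expn_gt0 prime_gt0.
set q := (p ^ k)%N in Xq q0; pose E := D.+1.*2; pose Z := newton S u b (k * E).
have [A0 [A1 [nzA sA0 sA1 bdA dvA]]] := siegel_pair D a Z q0.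
exists A0, A1; split=> // t z tX zW pt pz S0 Ha Hb nS'.
have Ht := padic_denq pp pt; have Hz := padic_denq pp pz.
have HZ : padic p (k * E) (z - evT t Z).
  apply: padicW (newton_padic pp Ht Hz Hb S0 _ (k * E)) => //.
  rewrite deriv_map.
  set e := (map_poly _ _).[_].
  have -> : 1 - u%:~R * e = (1 - u%:~R * s0%:~R) - u%:~R * (e - s0%:~R) by ring.
  apply: padicB => //; apply: padic_mull => //; [exact: padic_int|exact: close].
(* Expand at T = a: the coefficient of index i carries q^(E - i) by the choice of [A0] and [A1], and
   (t - a)^i carries q^i. *)
have HG : padic p (k * E) (evT t (A0 + A1 * Z)).
  pose G := (A0 + A1 * Z) \Po ('X + a%:P).
  have -> : evT t (A0 + A1 * Z) = (map_poly intr G).[t - a%:~R].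
    by rewrite /G map_comp_poly horner_comp map_polyXaddC hornerD hornerX hornerC subrK.
  rewrite horner_coef; apply: padic_sum => // i _; rewrite coef_map /=.
  have Hi := padicX pp i Ha.
  have [ltiE|leEi] := ltnP i E; last first.
    apply: padic_mull => //; first exact: padic_int.
    by apply: padicW Hi; rewrite leq_mul2l leEi orbT.
  have -> : (k * E = k * (E - i) + k * i)%N by rewrite -mulnDr subnK // ltnW.
  by apply: padicM => //; apply/padic_intP => //; rewrite expnM; apply: dvA.
have HV : padic p (k * E) (evT t A0 + evT t A1 * z).
  have -> : evT t A0 + evT t A1 * z = evT t (A0 + A1 * Z) + evT t A1 * (z - evT t Z).
    by rewrite rmorphD rmorphM /=; ring.
  apply: padicD => //; apply: padic_mull => //; rewrite evTE; apply: padic_horner => // i.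
  by rewrite coef_map; apply: padic_int.
pose A := A1%:P * 'X + A0%:P : {poly {poly int}}.
have cA i : A`_i = if i is 0%N then A0 else if i is 1%N then A1 else 0.
  by rewrite /A coefD coefMX coefC; case: i => [|[|i]] //=; rewrite ?add0r ?coefC ?addr0.
have [N [EN bN]] : exists N : int, [/\
    (map_poly (evT t) A).[z] * ((denq t)%:~R ^+ D * (denq z)%:~R ^+ 1) = N%:~R
    & (`|N| <= D.+1 * 2 * (q ^ D.+2 * X ^ D * W ^ 1))%N].
  apply: bihomogenize => //.
  - by apply/leq_sizeP => j; rewrite cA; case: j => [|[|j]].
  - by move=> i; rewrite cA; case: i => [|[|i]] //; rewrite size_poly0.
  - by move=> i j; rewrite cA; case: i => [|[|i]] //; rewrite ?coef0 //; case: (bdA j).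
have EA : (map_poly (evT t) A).[z] = evT t A0 + evT t A1 * z.
  by rewrite /A rmorphD rmorphM /= map_polyX !map_polyC /= !hornerE addrC.
rewrite {}EA in EN.
have dvN : (q ^ E %| `|N|)%N.
  rewrite /q -expnM; apply/padic_intP => //; rewrite -EN mulrC; apply: padic_mull => //.
  by rewrite expr1 -rmorphXn -intrM; apply: padic_int.
(* Size against divisibility: after cancelling q^(D+2) it remains to see that 2(D+1) W X^D < q^D,
   which follows from 4X <= q and [hD]. *)
have N0 : N = 0.
  apply/eqP; rewrite -absz_eq0; apply: contraTT dvN => nzN.
  rewrite gtnNdvd ?lt0n //; apply: (leq_ltn_trans bN).
  have XD : (4 ^ D * X ^ D <= q ^ D)%N by rewrite -expnMn; apply: leq_exp2r_any.
  have -> : (q ^ E = q ^ D.+2 * q ^ D)%N by rewrite -expnD /E; congr (_ ^ _)%N; lia.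
  have -> : (D.+1 * 2 * (q ^ D.+2 * X ^ D * W ^ 1) = q ^ D.+2 * (D.+1 * 2 * W * X ^ D))%N.
    by rewrite expn1; ring.
  rewrite ltn_pmul2l; last by rewrite expn_gt0 q0.
  refine (leq_trans _ XD).
  by rewrite ltn_pmul2r ?expn_gt0 ?X0.
move/eqP: EN; rewrite N0 mulf_eq0 => /orP[/eqP//|].
by rewrite expr1 -rmorphXn -intrM intr_eq0 mulf_eq0 expf_eq0 !(negbTE (denq_neq0 _)) andbF.
Qed.

(** * Counting rational points by residue classes *)

Lemma seq_choice (T : eqType) (K : Type) (s : seq T) (Q : T -> K -> Prop) (k0 : K) :
  (forall t, t \in s -> exists k, Q t k) -> exists g : T -> K, forall t, t \in s -> Q t (g t).
Proof.
elim: s => [|t s IHs] H; first by exists (fun=> k0).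
have [g Hg] := IHs (fun t' ts => H t' (mem_behead (s := t :: s) ts)).
have [k Hk] := H t (mem_head t s).
exists (fun t' => if t' == t then k else g t') => t'.
by case: eqP => [->//|/eqP ne]; rewrite inE (negbTE ne); apply: Hg.
Qed.

Lemma size_classes (T : eqType) (K : finType) (s : seq T) (Q : K -> T -> Prop) (B : nat) :
    uniq s -> (forall t, t \in s -> exists k, Q k t) ->
    (forall k (s' : seq T), uniq s' -> {subset s' <= s} ->
      (forall t, t \in s' -> Q k t) -> (size s' <= B)%N) ->
  (size s <= #|K| * B)%N.
Proof.
move=> us HQ HB; case: s us HQ HB => [|t0 s] // us HQ HB.
have [k0 _] := HQ t0 (mem_head _ _).
have [g Hg] := seq_choice k0 HQ.
rewrite -sum1_size (partition_big g predT) //=.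
apply: (@leq_trans (\sum_(k : K) B)); last by rewrite sum_nat_const.
apply: leq_sum => k _; rewrite sum1_count -size_filter; apply: (HB k).
- exact: filter_uniq.
- by move=> t; rewrite mem_filter => /andP[].
- by move=> t; rewrite mem_filter => /andP[/eqP<- /Hg].
Qed.

Lemma intr_Fp_eq0 p (n : int) : prime p -> (n%:~R == 0 :> 'F_p) = (p %| `|n|)%N.
Proof.
move=> pp; rewrite (dvdn_pcharf (pchar_Fp pp)).
by case: n => n; rewrite ?NegzE ?abszN //= intrN oppr_eq0.
Qed.

Lemma size_roots_mod p (P : {poly int}) i : prime p -> ~~ (p %| `|(P`_i)%R|)%N ->
  (size [seq b <- iota 0 p | (p %| `|(P.[b%:Z])%R|)%N] < size P)%N.
Proof.
move=> pp Pi; pose Q : {poly 'F_p} := map_poly intr P.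
have Q0 : Q != 0.
  by apply: contra Pi => /eqP Q0; rewrite -intr_Fp_eq0 // -coef_map -/Q Q0 coef0.
apply: leq_trans (size_poly _ _ : size Q <= _)%N.
set s := filter _ _; rewrite -(size_map (fun b : nat => b%:R : 'F_p)).
apply: max_poly_roots => //.
  apply/allP => x /mapP[b]; rewrite mem_filter => /andP[Pb _] ->.
  by rewrite /root -[b%:R]/((b%:Z)%:~R) horner_map /= intr_Fp_eq0.
rewrite map_inj_in_uniq ?filter_uniq ?iota_uniq // => b c.
rewrite !mem_filter !mem_iota !add0n /= => /andP[_ bp] /andP[_ cp] /(congr1 val).
by rewrite /= !val_Fp_nat // !modn_small.
Qed.

(** Used in contraposed form: a derivative that is nonzero modulo p shows that the polynomial itself
    is nonzero modulo p, hence has few roots there. *)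
Lemma dvd_deriv_horner p (P : {poly int}) b : prime p ->
  (forall i, p %| `|(P`_i)%R|)%N -> (p %| `|(P^`().[b])%R|)%N.
Proof.
move=> pp HP; rewrite -intr_Fp_eq0 // -horner_map -deriv_map.
have -> : map_poly intr P = 0 :> {poly 'F_p}.
  by apply/polyP => i; rewrite coef_map coef0; apply/eqP; rewrite intr_Fp_eq0.
by rewrite deriv0 horner0.
Qed.

Lemma padic_residue p k t : prime p -> ~~ (p %| `|denq t|)%N ->
  exists2 a : nat, (a < p ^ k)%N & padic p k (t - a%:~R).
Proof.
move=> pp pt; have q0 : (0 < p ^ k)%N by rewrite expn_gt0 prime_gt0.
have : coprimez (denq t) (p ^ k)%N.
  by rewrite /coprimez /gcdz eqz_nat -/(coprime _ _) coprime_sym coprimeXl // prime_coprime.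
case/coprimezP=> [[u v] /= E].
pose a := `|((numq t * u)%R %% (p ^ k)%N%:Z)%Z|%N.
have Ea : a%:Z = ((numq t * u)%R %% (p ^ k)%N%:Z)%Z.
  by rewrite /a gez0_abs // modz_ge0 // eqz_nat -lt0n.
exists a; first by rewrite -ltz_nat Ea ltz_pmod.
exists (numq t * v + ((numq t * u)%R %/ (p ^ k)%N%:Z)%Z * denq t), (denq t); split=> //.
rewrite mulrBl -{1}(divq_num_den t) divfK ?denq_neq0Q //.
rewrite -[a%:~R]/((a%:Z)%:~R) -intrM -intrB; congr (_ %:~R).
have := divz_eq (numq t * u) (p ^ k)%N; rewrite -Ea => E1.
have -> : numq t - a%:Z * denq t = numq t * (u * denq t + v * (p ^ k)%N) - a%:Z * denq t.
  by rewrite E mulr1.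
by move: E1; set c := (_ %/ _)%Z => E1; rewrite mulrDr mulrA E1; ring.
Qed.

Lemma padic_bev_sub p k (S : {poly {poly int}}) t t' z z' : prime p ->
  padic p 0 t -> padic p 0 z -> padic p k (t' - t) -> padic p k (z' - z) ->
  padic p k ((map_poly (evT t') S).[z'] - (map_poly (evT t) S).[z]).
Proof.
move=> pp Ht Hz Htt Hzz.
have Ht' : padic p 0 t' by rewrite -(subrK t t'); apply: padicD => //; apply: padicW Htt.
have Hz' : padic p 0 z' by rewrite -(subrK z z'); apply: padicD => //; apply: padicW Hzz.
rewrite -[_ - _](subrKA ((map_poly (evT t') S).[z])); apply: padicD => //.
  by apply: padic_horner_sub => //; apply: pintegral_evT.
rewrite -hornerN -hornerD  horner_coef; apply: padic_sum => // i _.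
rewrite mulrC; apply: padic_mull => //; first by have := padicX pp i Hz.
by rewrite coefB !coef_map; apply: padic_evT_sub.
Qed.

(** Here e + 1 is the multiplicity of z; the search ends because the last nonzero derivative is a
    constant. This replaces making the resolvent squarefree: coefficients of different factors may
    coincide, so its roots need not be simple. *)
Lemma simple_root_derivn (P : {poly rat}) m z : P != 0 -> (size P <= m.+1)%N -> P.[z] = 0 ->
  exists2 e, (e < m)%N & P^`(e).[z] = 0 /\ P^`(e.+1).[z] != 0.
Proof.
move=> P0 sP Pz; have sP0 : (0 < size P)%N by rewrite size_poly_gt0.
have lead : P^`((size P).-1).[z] != 0.
  have -> : P^`((size P).-1) = (lead_coef P *+ ((size P).-1)`!)%:P.
    apply/polyP => i; rewrite coef_derivn coefC; case: i => [|i] /=.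
      by rewrite addn0 ffactnn.
    rewrite nth_default ?mul0rn // -(ltn_predK sP0) /=; lia.
  by rewrite hornerC -mulr_natr mulf_eq0 lead_coef_eq0 (negbTE P0) pnatr_eq0 -lt0n fact_gt0.
have sP1 : (1 < size P)%N.
  rewrite ltnNge; apply/negP => /size1_polyC E; move: Pz P0; rewrite E hornerC => ->.
  by rewrite eqxx.
have ex : exists e, P^`(e.+1).[z] != 0.
  by exists (size P).-2; rewrite prednK // -ltnS prednK.
case: (ex_minnP ex) => e He mine; exists e.
  have : (e <= (size P).-2)%N by apply: mine; rewrite prednK // -ltnS prednK.
  lia.
split=> //; case: e He mine => [|e] He mine; first by rewrite derivn0.
by apply/eqP; apply: contraT => /mine; rewrite ltnn.
Qed.

Lemma leq_prod_const (M B : nat) (F : 'I_M -> nat) : (forall j, F j <= B)%N ->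
  (\prod_j F j <= B ^ M)%N.
Proof.
move=> FB; apply: (@leq_trans (\prod_(j < M) B)); first exact: leq_prod.
by rewrite prod_nat_const card_ord.
Qed.

Lemma size_coef_derivn (R : {poly {poly int}}) d e k :
  (forall k, size (R`_k)%R <= d)%N -> (size (R^`(e)`_k)%R <= d)%N.
Proof.
move=> sR; rewrite coef_derivn; apply/leq_sizeP => i le_i.
by rewrite coefMn (leq_sizeP _ _ (sR _)) ?mul0rn.
Qed.

Lemma size_derivn_le (A : nzRingType) (R : {poly A}) e : (size R^`(e) <= size R)%N.
Proof.
apply/leq_sizeP => i le_i; rewrite coef_derivn nth_default ?mul0rn //.
by apply: leq_trans le_i (leq_addl _ _).
Qed.

(* A class is given by p, t modulo q, and for each j the order e of the derivative
   of which z_j is a simple root, with the index of z_j modulo p among the roots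
   of that derivative modulo p. *)
Lemma count_classes (R : {poly {poly int}}) (M m d1 H L D X W G : nat)
    (ts : seq rat) (zf : rat -> 'I_M -> rat) :
    (size R <= m.+1)%N -> (forall k, size (R`_k)%R <= d1.+1)%N ->
    (forall e k i, (`|(R^`(e)`_k`_i)%R| <= H)%N) ->
    (0 < X)%N -> (D.+1 * 2 * W < 4 ^ D)%N -> (0 < L)%N ->
    (X * (W * (d1.+1 * m.+1 * (H * X ^ d1 * W ^ m))) ^ M < 2 ^ L)%N ->
    uniq ts ->
    (forall t, t \in ts -> (height t <= X)%N /\ forall j, [/\ (height (zf t j) <= W)%N,
        map_poly (evT t) R != 0 & (map_poly (evT t) R).[zf t j] = 0]) ->
    (forall (ts' : seq rat) (A0 A1 : 'I_M -> {poly int}), uniq ts' -> {subset ts' <= ts} ->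
      (forall j, [/\ (A0 j != 0) || (A1 j != 0), (size (A0 j) <= D.+1)%N, (size (A1 j) <= D.+1)%N
         & forall t, t \in ts' -> evT t (A0 j) + evT t (A1 j) * zf t j = 0]) ->
      (size ts' <= G)%N) ->
  (size ts <= (16 * L ^ 2).+1 * (4 * X * (16 * L ^ 2)).+1 * (m * m) ^ M * G)%N.
Proof.
move=> sR sRk HR X0 hD L0 hL uts Hts HG.
set P0 := (16 * L ^ 2)%N.
pose K := ('I_P0.+1 * 'I_(4 * X * P0).+1 * {ffun 'I_M -> 'I_m * 'I_m})%type.
have -> : (P0.+1 * (4 * X * P0).+1 * (m * m) ^ M = #|{: K}|)%N.
  by rewrite !card_prod card_ffun card_prod !card_ord.
pose kk p := up_log p (4 * X).
(* Recording the residue of z_j by its position among at most m roots keeps the number of choices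
   bounded; recording the residue itself would cost a factor p for every j. *)
pose rts (S : {poly {poly int}}) (a p : nat) :=
  [seq b <- iota 0 p | (p %| `|((map_poly (horner_eval a%:Z) S).[b%:Z])%R|)%N].
pose Q (k : K) (t : rat) := let p := k.1.1 : nat in let a := k.1.2 : nat in
  [/\ prime p, ~~ (p %| `|denq t|)%N, padic p (kk p) (t - a%:~R) &
    forall j, let e := (k.2 j).1 : nat in let b := nth 0%N (rts R^`(e) a p) (k.2 j).2 in
     [/\ ~~ (p %| `|denq (zf t j)|)%N, padic p 1 (zf t j - b%:~R),
       (map_poly (evT t) R^`(e)).[zf t j] = 0 &
       ~ padic p 1 (map_poly (evT t) (R^`(e))^`()).[zf t j]]].
have kk_gt0 p : (1 < p)%N -> (0 < kk p)%N.
  move=> p1; rewrite lt0n; apply/negP => /eqP kp0.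
  have := up_logP (4 * X) p1; rewrite -/(kk p) kp0 expn0; lia.
apply: (@size_classes _ _ _ Q) => //; last first.
  move=> k ts' uts' sub HQ.
  case: ts' uts' sub HQ => [|t0 ts'] // uts' sub HQ.
  have [pp _ _ _] := HQ _ (mem_head _ _); have p1 := prime_gt1 pp.
  have rel j : exists AA : {poly int} * {poly int},
    [/\ (AA.1 != 0) || (AA.2 != 0), (size AA.1 <= D.+1)%N, (size AA.2 <= D.+1)%N
         & forall t, t \in t0 :: ts' -> evT t AA.1 + evT t AA.2 * zf t j = 0].
    have [A0 [A1 [nz s0 s1 HA]]] := class_relation R^`((k.2 j).1)
       (k.1.2 : nat)%:Z (nth 0%N (rts R^`((k.2 j).1) k.1.2 k.1.1) (k.2 j).2)%:Z pp (kk_gt0 _ p1) X0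
       (up_logP _ p1) hD.
    exists (A0, A1); split=> //= t t_in; have [tX /(_ j)[zW _ _]] := Hts _ (sub _ t_in).
    have [_ pt ta /(_ j)[pz zb S0 S1]] := HQ _ t_in.
    by apply: HA.
  have [A HA] := fin_all_exists rel.
  apply: (HG _ (fun j => (A j).1) (fun j => (A j).2)) => //.
move=> t t_in; have [tX Hz] := Hts _ t_in.
(* The order e is that of the derivative with z_j as a simple root; the integer is the nonzero
   numerator of the next derivative at z_j. *)
have exN j : exists eN : nat * int, [/\ (eN.1 < m)%N, (map_poly (evT t) R^`(eN.1)).[zf t j] = 0,
     eN.2 != 0, (`|eN.2| <= d1.+1 * m.+1 * (H * X ^ d1 * W ^ m))%N &
     (map_poly (evT t) (R^`(eN.1))^`()).[zf t j] *
       ((denq t)%:~R ^+ d1 * (denq (zf t j))%:~R ^+ m) = eN.2%:~R].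
  have [zW P0' Pz] := Hz j.
  have [|e em [e0 e1]] := @simple_root_derivn _ m _ P0' _ Pz.
    by apply: leq_trans (size_poly _ _) sR.
  have [N [EN bN]] := @bihomogenize (R^`(e.+1)) d1 m H X W t (zf t j)
    (leq_trans (size_derivn_le _ _) sR) (fun k => size_coef_derivn _ _ sRk) (HR _) tX zW.
  exists (e, N) => /=; split=> //; first by rewrite -derivn_map.
    apply: contraNneq e1 => N0; move/eqP: EN; rewrite N0 derivn_map !mulf_eq0 !expf_eq0.
    by rewrite !(negbTE (denq_neq0Q _)) !andbF !orbF.
have [eN HeN] := fin_all_exists exN.
(* One integer that collects everything p must not divide; its size is what L measures. *)
pose delta := (`|denq t| * \prod_(j < M) (`|denq (zf t j)| * `|(eN j).2|))%N.
have den_gt0 r : (0 < `|denq r|)%N by rewrite absz_gt0 denq_neq0.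
have delta_gt0 : (0 < delta)%N.
  rewrite muln_gt0 den_gt0 prodn_gt0 // => j.
  by have [_ _ nz _ _] := HeN j; rewrite muln_gt0 den_gt0 absz_gt0.
have delta_lt : (delta < 2 ^ L)%N.
  apply: leq_ltn_trans hL; apply: leq_mul; first exact: height_den.
  apply: leq_prod_const => j; have [_ _ _ bN _] := HeN j; have [zW _ _] := Hz j.
  by apply: leq_mul => //; apply: height_den.
have [p pp /andP[pP0 pdelta]] := prime_avoid L0 delta_gt0 delta_lt.
have p1 := prime_gt1 pp.
have pt : ~~ (p %| `|denq t|)%N by apply: contra pdelta => H1; rewrite dvdn_mulr.
have pj j : ~~ (p %| `|denq (zf t j)|)%N && ~~ (p %| `|(eN j).2|)%N.
  rewrite -negb_or -Euclid_dvdM //; apply: contra pdelta => H1.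
  by rewrite dvdn_mull // (bigD1 j) //= dvdn_mulr.
have [a lt_a Ha] := padic_residue (kk p) pp pt.
(* By minimality of the exponent, p^(k-1) < 4X, so the modulus exceeds 4X by less than a factor
   p. *)
have lt_a' : (a < (4 * X * P0).+1)%N.
  apply: leq_trans lt_a _; apply: leqW.
  have -> : (p ^ kk p = p ^ (kk p).-1 * p)%N by rewrite -expnSr prednK ?kk_gt0.
  apply: leq_mul => //; apply: ltnW; apply: up_log_gtn => //; lia.
have Ht := padic_denq pp pt.
have exI j : exists I : 'I_m * 'I_m, let e := I.1 : nat in
   let b := nth 0%N (rts R^`(e) a p) I.2 in
   [/\ ~~ (p %| `|denq (zf t j)|)%N, padic p 1 (zf t j - b%:~R),
       (map_poly (evT t) R^`(e)).[zf t j] = 0 &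
       ~ padic p 1 (map_poly (evT t) (R^`(e))^`()).[zf t j]].
  have [em S0 nz _ EN] := HeN j; have /andP[pz pN] := pj j.
  set e := (eN j).1 in em S0 EN; set S := R^`(e) in S0 EN *.
  have Hzj := padic_denq pp pz.
  have nS' : ~ padic p 1 (map_poly (evT t) S^`()).[zf t j].
    move=> HS; move/negP: pN; apply; rewrite -[p]expn1; apply/padic_intP => //.
    rewrite -EN mulrC; apply: padic_mull => //.
    by rewrite -!rmorphXn -intrM; apply: padic_int.
  have [b + Hb] := padic_residue 1 pp pz; rewrite expn1 => lt_b.
  have ta1 : padic p 1 (a%:~R - t).
    by rewrite -opprB; apply: padicN; apply: padicW Ha; apply: kk_gt0.
  have zb1 : padic p 1 (b%:~R - zf t j) by rewrite -opprB; apply: padicN.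
  have evI (S1 : {poly {poly int}}) :
     (map_poly (evT a%:~R) S1).[b%:~R] = ((map_poly (horner_eval a%:Z) S1).[b%:Z])%:~R.
    rewrite -horner_map -map_poly_comp; congr (_.[_]); apply: eq_map_poly => P /=.
    by rewrite evTE horner_map.
  have pb : (p %| `|((map_poly (horner_eval a%:Z) S).[b%:Z])%R|)%N.
    rewrite -[p]expn1; apply/padic_intP => //; rewrite -evI -[X in padic _ _ X]subr0 -S0.
    exact: padic_bev_sub.
  have pb' : ~~ (p %| `|((map_poly (horner_eval a%:Z) S^`()).[b%:Z])%R|)%N.
    apply/negP; rewrite -{1}[p]expn1 => /padic_intP => /(_ pp); rewrite -evI => H1.
    apply: nS'; rewrite -[X in padic _ _ X](subKr ((map_poly (evT a%:~R) S^`()).[b%:~R])).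
    by apply: padicB => //; apply: padic_bev_sub.
  (* The polynomial S(a, Z) does not vanish identically modulo p, because its derivative at b does
     not. *)
  have [i pi] : exists i, ~~ (p %| `|((map_poly (horner_eval a%:Z) S)`_i)%R|)%N.
    case: (boolP [forall i : 'I_(size (map_poly (horner_eval a%:Z) S)),
        p %| `|((map_poly (horner_eval a%:Z) S)`_i)%R|]%N) => [/forallP Hall|]; last first.
      by rewrite negb_forall => /existsP[i Hi]; exists i.
    case/negP: pb'; rewrite -deriv_map; apply: dvd_deriv_horner => // i.
    by case: (ltnP i (size (map_poly (horner_eval a%:Z) S))) => [lt_i|le_i];
      [apply: (Hall (Ordinal lt_i))|rewrite nth_default // absz0 dvdn0].
  have lt_i : (index b (rts S a p) < m)%N.
    have b_in : b \in rts S a p by rewrite mem_filter pb mem_iota add0n lt_b.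
    have sS : (size (map_poly (horner_eval a%:Z) S) <= m.+1)%N.
      by apply: leq_trans (size_poly _ _) (leq_trans (size_derivn_le _ _) sR).
    apply: leq_trans (_ : size (rts S a p) <= m)%N; first by rewrite index_mem.
    by rewrite -ltnS; apply: leq_trans (size_roots_mod pp pi) sS.
  exists (Ordinal em, Ordinal lt_i) => /=; rewrite -/S.
  rewrite nth_index //.
  by rewrite mem_filter pb mem_iota add0n lt_b.
have [phi Hphi] := fin_all_exists exI.
exists (Ordinal (pP0 : (p < P0.+1)%N), Ordinal lt_a', finfun phi).
by split=> // j; rewrite /= !ffunE; apply: Hphi.
Qed.

(** * Resolvents *)

(** Chosen instead of the largest coefficient because it is submultiplicative: products and powers
    bring no factor depending on the degree. *)
Definition l1norm (P : {poly int}) : nat := (\sum_(i < size P) `|(P`_i)%R|)%N.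

Lemma l1normE n (P : {poly int}) : (size P <= n)%N ->
  l1norm P = (\sum_(i < n) `|(P`_i)%R|)%N.
Proof.
move=> sP; rewrite /l1norm (big_ord_widen n (fun i => `|(P`_i)%R|%N) sP) big_mkcond.
apply: eq_bigr => i _; case: ltnP => // le_i.
by rewrite nth_default.
Qed.

Lemma leq_coef_l1norm (P : {poly int}) i : (`|(P`_i)%R| <= l1norm P)%N.
Proof.
have [lt_i|le_i] := ltnP i (size P); last by rewrite nth_default.
by rewrite /l1norm (bigD1 (Ordinal lt_i)) //= leq_addr.
Qed.

Lemma l1normD (P Q : {poly int}) : (l1norm (P + Q) <= l1norm P + l1norm Q)%N.
Proof.
set n := maxn (size P) (size Q).
rewrite (@l1normE n (P + Q)) ?size_polyD // (@l1normE n P) ?leq_maxl // (@l1normE n Q) ?leq_maxr //.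
by rewrite -big_split; apply: leq_sum => i _; rewrite coefD; apply: leq_abszD.
Qed.

Lemma l1normN (P : {poly int}) : l1norm (- P) = l1norm P.
Proof. by rewrite /l1norm size_polyN; apply: eq_bigr => i _; rewrite coefN abszN. Qed.

Lemma l1normC (c : int) : l1norm c%:P = `|c|%N.
Proof. by rewrite (@l1normE 1) ?size_polyC_leq1 // big_ord1 coefC. Qed.

Lemma l1normCM (c : int) P : (l1norm (c%:P * P) <= `|c| * l1norm P)%N.
Proof.
rewrite (@l1normE (size P)); last by rewrite mul_polyC size_scale_leq.
rewrite /l1norm big_distrr /=; apply: leq_sum => i _.
by rewrite coefCM abszM.
Qed.

Lemma l1normMXD (P : {poly int}) c : l1norm (P * 'X + c%:P) = (l1norm P + `|c|)%N.
Proof.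
rewrite (@l1normE (size P).+1); last by rewrite size_MXaddC; case: ifP.
rewrite big_ord_recl coefD coefMX coefC /= add0r addnC; congr (_ + _)%N.
by apply: eq_bigr => i _; rewrite coefD coefMX coefC /= addr0.
Qed.

Lemma l1normM (P Q : {poly int}) : (l1norm (P * Q) <= l1norm P * l1norm Q)%N.
Proof.
elim/poly_ind: P => [|P c IHP].
  by rewrite mul0r /l1norm size_poly0 big_ord0.
rewrite l1normMXD mulrDl mulrAC mulnDl; apply: leq_trans (l1normD _ _) _.
apply: leq_add; last exact: l1normCM.
by apply: leq_trans IHP; rewrite -[_ * 'X]addr0 -(polyC0) l1normMXD absz0 addn0.
Qed.

Lemma l1norm_sum (I : Type) (s : seq I) (F : I -> {poly int}) :
  (l1norm (\sum_(i <- s) F i) <= \sum_(i <- s) l1norm (F i))%N.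
Proof.
elim: s => [|i s IHs]; first by rewrite !big_nil /l1norm size_poly0 big_ord0.
rewrite !big_cons; apply: leq_trans (l1normD _ _) _.
by rewrite leq_add2l.
Qed.

Lemma l1normX (P : {poly int}) n : (l1norm (P ^+ n) <= l1norm P ^ n)%N.
Proof.
elim: n => [|n IHn]; first by rewrite expr0 -polyC1 l1normC.
rewrite exprS expnS; apply: leq_trans (l1normM _ _) _.
by rewrite leq_mul2l IHn orbT.
Qed.

Lemma l1norm_prod (I : Type) (s : seq I) (F : I -> {poly int}) :
  (l1norm (\prod_(i <- s) F i) <= \prod_(i <- s) l1norm (F i))%N.
Proof.
elim: s => [|i s IHs]; first by rewrite !big_nil -polyC1 l1normC.
rewrite !big_cons; apply: leq_trans (l1normM _ _) _.
by rewrite leq_mul2l IHs orbT.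
Qed.

Lemma size_exp_leq1 (P : {poly int}) d n : (size P <= d.+1)%N -> (size (P ^+ n)%R <= (n * d).+1)%N.
Proof.
move=> sP; apply: leq_trans (size_poly_exp_leq _ _) _.
by rewrite ltnS mulnC leq_mul2l -ltnS (leq_trans (leqSpred _)) ?orbT //; lia.
Qed.

Lemma size_mul_leq1 (P Q : {poly int}) a b : (size P <= a.+1)%N -> (size Q <= b.+1)%N ->
  (size (P * Q)%R <= (a + b).+1)%N.
Proof. by move=> sP sQ; apply: leq_trans (size_polyMleq _ _) _; lia. Qed.

Section Universal.
Variable N : nat.
Local Notation A := {mpoly {poly int}[N]}.

(* The coefficient ring {poly int} of A carries the resolvent variable Z. *)
Definition root_subset_poly (I : {set 'I_N}) : {poly A} := \prod_(i in I) ('X - ('X_i)%:P).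

(** As a polynomial in Z its roots are all coefficients of all monic divisors of the generic split
    polynomial. Permuting the variables permutes the subsets, whence the symmetry. The index j runs
    up to N for every subset, so that leading ones and padding zeros are roots too. *)
Definition universal_resolvent : A :=
  \prod_(I : {set 'I_N}) \prod_(j < N.+1) (('X : {poly int})%:MP - (root_subset_poly I)`_j).

Lemma universal_resolvent_sym : universal_resolvent \is symmetric.
Proof.
apply/issymP => s; rewrite rmorph_prod.
rewrite [RHS](reindex_inj (imset_inj (@perm_inj _ s))) /=; apply: eq_bigr => I _.
rewrite rmorph_prod; apply: eq_bigr => j _.
rewrite rmorphB /= [X in X - _]mmapC; congr (_ - _).
rewrite -coef_map /= /root_subset_poly rmorph_prod /=; congr (_`_ _).
rewrite big_imset /=; last by move=> x y _ _; apply: perm_inj.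
rewrite (eq_bigr (fun i => 'X - ('X_(s i))%:P)) // => i _; rewrite rmorphB /= map_polyX map_polyC /=.
by rewrite /msym mmapX mmap1U.
Qed.

Lemma universal_resolvent_eval (L : idomainType) (al : 'I_N -> L) :
  mmap (map_poly (intr : int -> L)) (fun i => (al i)%:P) universal_resolvent =
  \prod_(I : {set 'I_N}) \prod_(j < N.+1)
     ('X - (((\prod_(i in I) ('X - (al i)%:P))`_j)%:P)).
Proof.
rewrite rmorph_prod; apply: eq_bigr => I _; rewrite rmorph_prod; apply: eq_bigr => j _.
rewrite rmorphB /= mmapC (_ : _ 'X = 'X); last exact: map_polyX.
congr (_ - _); rewrite -coef_map /= -[RHS](coef_map polyC) /root_subset_poly !rmorph_prod /=; congr (_`_ _).
transitivity (\prod_(i in I) ('X - (al i)%:P%:P)).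
  rewrite (eq_bigr (fun i => 'X - (al i)%:P%:P)) // => i _.
  by rewrite rmorphB /= map_polyX map_polyC /= mmapX mmap1U.
rewrite [X in _ = polyseq X](eq_bigr (fun i => 'X - (al i)%:P%:P)) // => i _.
by rewrite rmorphB /= map_polyX map_polyC.
Qed.

End Universal.

Lemma monic_dvdp_prod_XsubC (L : fieldType) (N : nat) (al : 'I_N -> L) (u : {poly L}) :
  u \is monic -> u %| \prod_(i < N) ('X - (al i)%:P) ->
  exists I : {set 'I_N}, u = \prod_(i in I) ('X - (al i)%:P).
Proof.
move=> um /dvdp_prod_XsubC[m Em]; exists [set i in mask m (index_enum 'I_N)].
apply/eqP; rewrite -eqp_monic //; last by apply: monic_prod => i _; apply: monicXsubC.
apply: eqp_trans Em _.
rewrite [X in _ %= X](eq_bigl (fun i => i \in mask m (index_enum 'I_N))); last by move=> i; rewrite inE.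
rewrite -big_uniq ?eqpxx //; apply: mask_uniq; exact: index_enum_uniq.
Qed.

Lemma mmap_mesym (R S : comNzRingType) (f : {rmorphism R -> S}) N (al : 'I_N -> S) k :
  mmap f al (mesym N R k) = \sum_(h : {set 'I_N} | #|h| == k) \prod_(i in h) al i.
Proof.
rewrite /mesym rmorph_sum; apply: eq_bigr => h _; rewrite rmorph_prod; apply: eq_bigr => i _.
by rewrite /= mmapX mmap1U.
Qed.

Lemma coef_prod_XsubC_mesym (L : idomainType) N (al : 'I_N -> L) k : (k <= N)%N ->
  (\prod_(i < N) ('X - (al i)%:P))`_(N - k) =
    (-1) ^+ k * \sum_(h : {set 'I_N} | #|h| == k) \prod_(i in h) al i.
Proof.
move=> kN; have := mroots_coeff [tuple al i | i < N] (Ordinal (kN : (k < N.+1)%N)) => /=.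
rewrite big_map big_enum => ->; congr (_ * _).
rewrite /meval mmap_mesym; apply: eq_bigr => h _; apply: eq_bigr => i _.
by rewrite tnth_mktuple.
Qed.

Lemma mmap_comp_mpoly (R S : comNzRingType) (f : {rmorphism R -> S}) N n
    (U : {mpoly R[N]}) (lq : N.-tuple {mpoly R[n]}) (al : 'I_n -> S) :
  mmap f al (U \mPo lq) = mmap f (fun i => mmap f al (tnth lq i)) U.
Proof.
rewrite /comp_mpoly [X in mmap f al X = _]/mmap [RHS]/mmap rmorph_sum.
apply: eq_bigr => m _; rewrite rmorphM /= mmapC; congr (_ * _).
by rewrite /mmap1 rmorph_prod; apply: eq_bigr => i _; rewrite rmorphXn.
Qed.

Lemma mmap_sumE (R S : nzRingType) N (f : R -> S) (h : 'I_N -> S) (p : {mpoly R[N]}) :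
  mmap f h p = \sum_(m <- msupp p) f p@_m * mmap1 h m.
Proof. by []. Qed.

(** The universal resolvent is a polynomial [U] in the elementary symmetric functions, and [U]
    depends on N alone. Hence so do the three constants, whatever F is substituted. *)
Lemma resolvent_exists (N : nat) : exists m Md CU : nat,
  forall F : {poly {poly int}}, size F = N.+1 ->
  exists R : {poly {poly int}}, [/\ (size R <= m.+1)%N,
    forall d, (forall j, size (F`_j)%R <= d.+1)%N ->
       forall k, (size (R`_k)%R <= (Md * d).+1)%N,
    forall H, (0 < H)%N -> (forall j, l1norm (F`_j)%R <= H)%N ->
       forall k i, (`|(R`_k`_i)%R| <= CU * H ^ Md)%N
    & forall t, evT t F`_N != 0 -> map_poly (evT t) R != 0 /\
        forall u v : {poly rat}, u \is monic -> map_poly (evT t) F = u * v ->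
        forall j : 'I_N.+1, (map_poly (evT t) R).[u`_j] = 0 ].
Proof.
have [U [EU _]] := sym_fundamental (universal_resolvent_sym N).
pose m := (\max_(mu <- msupp U) size (U@_mu)%R)%N.
pose Md := msize U.
pose CU := (\sum_(mu <- msupp U) l1norm (U@_mu)%R)%N.
exists m, Md, CU => F sF.
pose c := F`_N.
(* By Vieta, e_(i+1) equals (-1)^(i+1) F_(N-i-1) / c. Multiplying through by c^Md clears all
   denominators, since no monomial of [U] has degree above [Md]. *)
pose G (mu : 'X_{1..N}) : {poly int} :=
  c ^+ (Md - mdeg mu) * \prod_(i < N) ((-1) ^+ i.+1 * F`_(N - i.+1)) ^+ mu i.
pose lift (V : {poly int}) : {poly {poly int}} := map_poly polyC V.
pose R := \sum_(mu <- msupp U) lift U@_mu * (G mu)%:P.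
have mdegM mu : mu \in msupp U -> (mdeg mu <= Md)%N.
  by move=> /msize_mdeg_lt /ltnW.
have coefR k : R`_k = \sum_(mu <- msupp U) (U@_mu`_k)%:P * G mu.
  rewrite coef_sum; apply: eq_bigr => mu _.
  by rewrite coefMC /lift coef_map.
exists R; split.
- apply: (leq_trans (size_sum _ _ _)); apply/bigmax_leqP_seq => mu mu_in _.
  apply: leq_trans (size_polyMleq _ _) _.
  apply: leq_trans (leq_pred _) _; rewrite -addn1; apply: leq_add; last exact: size_polyC_leq1.
  apply: leq_trans (size_poly _ _) _.
  exact: (@leq_bigmax_seq _ (msupp U) xpredT (fun mu => size U@_mu)).
- move=> d Hd k; rewrite coefR; apply: (leq_trans (size_sum _ _ _)).
  apply/bigmax_leqP_seq => mu mu_in _.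
  have -> : (Md * d = 0 + ((Md - mdeg mu) * d + (mdeg mu) * d))%N.
    by rewrite add0n -mulnDl subnK // mdegM.
  apply: size_mul_leq1; first exact: size_polyC_leq1.
  apply: size_mul_leq1; first by apply: size_exp_leq1; apply: Hd.
  rewrite mdegE big_distrl /=; elim/big_ind2: _ => //.
  - by rewrite size_poly1.
  - by move=> x1 y1 x2 y2; apply: size_mul_leq1.
  - move=> i _; apply: size_exp_leq1.
    rewrite -signr_odd; case: odd; rewrite ?expr1 ?expr0 ?mulN1r ?mul1r ?size_polyN //.
- move=> H H0 HF k i; apply: leq_trans (leq_coef_l1norm _ _) _.
  rewrite coefR; apply: leq_trans (l1norm_sum _ _) _.
  rewrite /CU big_distrl /= big_seq [X in (_ <= X)%N]big_seq.
  apply: leq_sum => mu mu_in; apply: leq_trans (l1normCM _ _) _.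
  apply: leq_mul; first exact: leq_coef_l1norm.
  have -> : (H ^ Md = H ^ (Md - mdeg mu) * H ^ mdeg mu)%N by rewrite -expnD subnK // mdegM.
  apply: leq_trans (l1normM _ _) _; apply: leq_mul.
    by apply: leq_trans (l1normX _ _) _; apply: leq_exp2r_any; apply: HF.
  apply: leq_trans (l1norm_prod _ _) _; rewrite mdegE expn_sum.
  apply: leq_prod => j _; apply: leq_trans (l1normX _ _) _; apply: leq_exp2r_any.
  apply: leq_trans (HF (N - j.+1)%N).
  by rewrite -signr_odd; case: odd; rewrite ?expr1 ?expr0 ?mulN1r ?mul1r ?l1normN.
move=> t ct; set Ft := map_poly (evT t) F; set Rt := map_poly (evT t) R.
pose toC := map_poly (ratr : rat -> algC).
have lcFt : lead_coef Ft = evT t c.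
  by rewrite lead_coef_map_eq ?lead_coefE sF.
have sFt : size Ft = N.+1 by rewrite size_map_poly_id0 ?lead_coefE sF.
have [rs Ers] := closed_field_poly_normal (toC Ft).
have srs : size rs = N.
  have := congr1 (fun P : {poly algC} => size P) Ers; rewrite size_map_poly sFt.
  rewrite size_scale ?lead_coef_map ?lead_coef_eq0 -?size_poly_gt0 ?size_map_poly ?sFt //.
    by rewrite size_prod_XsubC => -[].
  by rewrite lcFt fmorph_eq0.
pose al (i : 'I_N) := rs`_i.
have {}Ers : toC Ft = ratr (evT t c) *: \prod_(i < N) ('X - (al i)%:P).
  rewrite {}Ers lead_coef_map lcFt; congr (_ *: _).
  by rewrite (big_nth 0) big_mkord srs.
have ct' : ratr (evT t c) != 0 :> algC by rewrite fmorph_eq0.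
have coefF k : (k <= N)%N -> ratr (evT t F`_(N - k)) =
    ratr (evT t c) * ((-1) ^+ k * \sum_(h : {set 'I_N} | #|h| == k) \prod_(i in h) al i) :> algC.
  move=> kN; rewrite -coef_prod_XsubC_mesym // -coefZ -Ers /toC !coef_map //.
(* Over the algebraic numbers, R(t, Z) is c(t)^Md times the universal resolvent evaluated at the
   roots of F(t, Y). *)
have key : toC Rt = (ratr (evT t c)) ^+ Md *:
  \prod_(I : {set 'I_N}) \prod_(j < N.+1)
     ('X - (((\prod_(i in I) ('X - (al i)%:P))`_j)%:P)).
  rewrite -universal_resolvent_eval -EU.
  rewrite mmap_comp_mpoly /Rt /R rmorph_sum /toC rmorph_sum /= mmap_sumE scaler_sumr.
  rewrite big_seq [RHS]big_seq; apply: eq_bigr => mu mu_in.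
  rewrite !rmorphM /= !map_polyC /=.
  have -> : map_poly ratr (map_poly (evT t) (lift U@_mu)) = map_poly intr U@_mu :> {poly algC}.
    rewrite /lift -!map_poly_comp; apply: eq_map_poly => k /=.
    by rewrite evTC ratr_int.
  rewrite scalerAr; congr (_ * _); rewrite /mmap1.
  pose e k : algC := \sum_(h : {set 'I_N} | #|h| == k) \prod_(i in h) al i.
  transitivity ((ratr (evT t c)) ^+ Md *: (\prod_(i < N) (e i.+1) ^+ mu i)%:P); last first.
    congr (_ *: _); rewrite rmorph_prod; apply: eq_bigr => i _.
    rewrite rmorphXn /= tnth_mktuple. rewrite (@mmap_mesym _ _ (map_poly (intr : int -> algC))); congr (_ ^+ _).
    by rewrite rmorph_sum; apply: eq_bigr => h _; rewrite rmorph_prod.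
  rewrite -mul_polyC -!polyCM; congr _%:P.
  have -> : ratr (evT t (c ^+ (Md - mdeg mu))) = (ratr (evT t c)) ^+ (Md - mdeg mu) :> algC.
    by rewrite !rmorphXn.
  have -> : ratr (evT t (\prod_(i < N) ((-1) ^+ i.+1 * F`_(N - i.+1)) ^+ mu i)) =
     \prod_(i < N) (ratr (evT t c) * e i.+1) ^+ mu i :> algC.
    rewrite !rmorph_prod; apply: eq_bigr => i _.
    transitivity (ratr (evT t (((-1) ^+ i.+1 * F`_(N - i.+1)) ^+ mu i)) : algC); first by [].
    have -> : evT t (((-1) ^+ i.+1 * F`_(N - i.+1)) ^+ mu i) =
       ((-1) ^+ i.+1 * evT t F`_(N - i.+1)) ^+ mu i.
      by rewrite rmorphXn rmorphM rmorphXn rmorphN1.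
    have -> : ratr (((-1) ^+ i.+1 * evT t F`_(N - i.+1)) ^+ mu i) =
       ((-1) ^+ i.+1 * ratr (evT t F`_(N - i.+1))) ^+ mu i :> algC.
      by rewrite rmorphXn rmorphM rmorphXn rmorphN1.
    rewrite coefF ?ltn_ord // mulrCA [X in _ * X]mulrA -exprMn mulrNN mul1r expr1n mul1r.
    by [].
  rewrite -{2}(subnK (mdegM mu mu_in)).
  under eq_bigr do rewrite exprMn.
  rewrite big_split /= prodrXr -mdegE exprD.
  by rewrite [RHS]mulrAC [LHS]mulrA [RHS]mulrAC.
have monic_key (I : {set 'I_N}) (j : 'I_N.+1) : 'X - (((\prod_(i in I) ('X - (al i)%:P))`_j)%:P) != 0 by rewrite polyXsubC_eq0.
split.
  rewrite -(map_poly_eq0 (ratr : {rmorphism rat -> algC})) -/(toC Rt) key scaler_eq0 expf_eq0.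
  rewrite (negbTE ct') andbF /=; apply/prodf_neq0 => I _; apply/prodf_neq0 => j _.
  exact: monic_key.
move=> u v um Euv j; apply: (fmorph_inj (ratr : {rmorphism rat -> algC})).
rewrite rmorph0 -horner_map /= -/(toC Rt) key hornerZ horner_prod.
(* A monic factor over Q is the product over some subset I of the complex roots, so the factor of
   the resolvent indexed by I and j vanishes at its coefficient. *)
have [I EI] : exists I : {set 'I_N}, toC u = \prod_(i in I) ('X - (al i)%:P).
  apply: monic_dvdp_prod_XsubC; first by rewrite map_monic.
  rewrite -(dvdpZr _ _ ct') -Ers Euv /toC rmorphM /=; exact: dvdp_mulr.
rewrite (bigD1 I) //= horner_prod (bigD1 j) //= hornerXsubC -EI coef_map subrr.
by rewrite !mul0r mulr0.
Qed.

(** * Heights of rational roots *)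

Lemma horner_clear (P : {poly int}) n z : (size P <= n.+1)%N ->
  (map_poly intr P).[z] * (denq z)%:~R ^+ n =
   (\sum_(i < n.+1) P`_i * (numq z ^+ i * denq z ^+ (n - i)))%:~R :> rat.
Proof.
move=> sP; rewrite -evTE (evT_sum _ sP) mulr_suml rmorph_sum; apply: eq_bigr => i _ /=.
have le_in : (i <= n)%N by rewrite -ltnS.
by rewrite -mulrA (rat_clear z le_in) -intrM.
Qed.

Lemma denq_dvd_root (P : {poly int}) z : P != 0 -> (map_poly intr P).[z] = 0 :> rat ->
  exists2 i, P`_i != 0 & (denq z %| P`_i)%Z.
Proof.
move=> P0 Pz; pose n := (size P).-1.
have sP : size P = n.+1 by rewrite /n prednK // size_poly_gt0.
exists n; first by rewrite -lead_coefE lead_coef_eq0.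
have := @horner_clear P n z; rewrite sP leqnn Pz mul0r => /(_ isT)/esym/eqP.
rewrite intr_eq0 big_ord_recr /= subnn expr0 mulr1 addrC addr_eq0 => /eqP E.
have : (denq z %| P`_n * numq z ^+ n)%Z.
  rewrite E rpredN; apply: rpred_sum => i _.
  by rewrite dvdz_mull // dvdz_mull // -(subnSK (ltn_ord i)) exprS dvdz_mulr.
by rewrite Gauss_dvdzl // coprimezXr // coprimez_sym; apply: coprime_num_den.
Qed.

Lemma numq_dvd_root (P : {poly int}) z : P != 0 -> z != 0 -> (map_poly intr P).[z] = 0 :> rat ->
  exists2 i, P`_i != 0 & (numq z %| P`_i)%Z.
Proof.
move=> + z0; elim/poly_ind: P => [|P c IHP]; first by rewrite eqxx.
rewrite rmorphD rmorphM /= map_polyX map_polyC /= !hornerE => Pc0 Pz.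
have [c0|c0] := eqVneq c 0.
  move: Pc0 Pz; rewrite c0 addr0 mulr0z addr0 => Pc0 /eqP; rewrite mulf_eq0 (negbTE z0) orbF => /eqP Pz.
  have [|i Pi dv] := IHP _ Pz; first by apply: contraNneq Pc0 => ->; rewrite mul0r.
  by exists i.+1; rewrite coefMX.
exists 0%N; rewrite coefD coefMX coefC /= add0r //.
pose n := size P; have E := @horner_clear P n z (leqnSn _).
set V := (\sum_(i < _) _) in E.
have : ((denq z ^+ n * (denq z * c) + V * numq z)%:~R == 0 :> rat).
  have -> : (denq z ^+ n * (denq z * c) + V * numq z)%:~R =
      (denq z)%:~R ^+ n * ((denq z)%:~R * ((map_poly intr P).[z] * z + c%:~R)) :> rat.
    by rewrite intrD !intrM -E numqE rmorphXn /=; ring.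
  by rewrite Pz !mulr0.
rewrite intr_eq0 addr_eq0 => /eqP E2.
have : (numq z %| denq z ^+ n.+1 * c)%Z.
  by rewrite exprSr -mulrA E2 rpredN dvdz_mull.
by rewrite Gauss_dvdzr // coprimezXr //; apply: coprime_num_den.
Qed.

Lemma height_root (P : {poly int}) z H : P != 0 -> (map_poly intr P).[z] = 0 :> rat ->
  (forall i, `|(P`_i)%R| <= H)%N -> (height z <= H)%N.
Proof.
move=> P0 Pz HP.
have dv_le a i : P`_i != 0 -> (a %| P`_i)%Z -> (`|a| <= H)%N.
  by move=> Pi; rewrite dvdzE => /dvdn_leq H1; apply: leq_trans (HP i); apply: H1; rewrite absz_gt0.
have [i Pi di] := denq_dvd_root P0 Pz; rewrite /height geq_max (dv_le _ _ Pi di) andbT.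
have [->|z0] := eqVneq z 0; first by rewrite (_ : numq 0 = 0).
by have [k Pk dk] := numq_dvd_root P0 z0 Pz; apply: dv_le Pk dk.
Qed.

(** Multiplying R(t, Z) by the d-th power of the denominator of t leaves bounded integer
    coefficients, to which the rational root theorem applies. This is the origin of the height bound
    W. *)
Lemma height_root_fiber (R : {poly {poly int}}) d H X t z :
    (forall k, size (R`_k)%R <= d.+1)%N -> (forall k i, `|(R`_k`_i)%R| <= H)%N ->
    (height t <= X)%N -> map_poly (evT t) R != 0 -> (map_poly (evT t) R).[z] = 0 ->
  (height z <= d.+1 * (H * X ^ d))%N.
Proof.
move=> sR HR tX R0 Rz.
pose P : {poly int} := \poly_(k < size R) (\sum_(i < d.+1) R`_k`_i * (numq t ^+ i * denq t ^+ (d - i))).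
have EP : map_poly intr P = (denq t)%:~R ^+ d *: map_poly (evT t) R.
  apply/polyP => k; rewrite coef_map coefZ coef_map coef_poly /=.
  rewrite mulrC evTE horner_clear //; case: ltnP => // le_k.
  rewrite nth_default // big1 ?mulr0z // => i _; by rewrite coef0 mul0r.
have d0 : (denq t)%:~R ^+ d != 0 :> rat by rewrite expf_neq0 // denq_neq0Q.
apply: (@height_root P).
- by apply: contra R0 => /eqP P0; move/eqP: EP; rewrite P0 rmorph0 eq_sym scaler_eq0 (negbTE d0).
- by rewrite EP hornerZ Rz mulr0.
move=> k; rewrite coef_poly; case: ltnP => // _.
apply: leq_trans (absz_sum _ _) _.
have -> : (d.+1 * (H * X ^ d) = \sum_(i < d.+1) H * X ^ d)%N by rewrite sum_nat_const card_ord.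
apply: leq_sum => i _; have id : (i <= d)%N by rewrite -ltnS.
rewrite !abszM !abszX; apply: leq_mul => //; rewrite -[Y in (_ <= _ ^ Y)%N](subnKC id) expnD.
by apply: leq_mul; apply: leq_exp2r_any; [apply: height_num|apply: height_den].
Qed.

(** * Kronecker substitution *)

Lemma mpoly_rmorph_eq n (K S : comNzRingType) (f g : {rmorphism {mpoly K[n]} -> S}) :
  (forall c, f c%:MP = g c%:MP) -> (forall j, f 'X_j = g 'X_j) -> f =1 g.
Proof.
move=> fgC fgX p; rewrite [p]mpolyE !rmorph_sum; apply: eq_bigr => m _.
rewrite -mul_mpolyC !rmorphM /= fgC; congr (_ * _).
rewrite mpolyXE_id !rmorph_prod; apply: eq_bigr => j _.
by rewrite !rmorphXn /= fgX.
Qed.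

Section Kronecker.
Variables (n D : nat).

Definition kwgt (m : 'X_{1..n}) : nat := (\sum_(j < n) m j * D ^ j)%N.

Definition kron (K : comNzRingType) : {mpoly K[n]} -> {poly K} :=
  mmap polyC (fun j : 'I_n => 'X^(D ^ j)).
HB.instance Definition _ K := GRing.RMorphism.on (@kron K).

(** Defined on every univariate polynomial and linear in its coefficients, so it commutes with
    specialization and can be applied to interpolated coefficients that need not come from a
    Kronecker substitution. *)
Definition unkron (K : comNzRingType) (u : {poly K}) : {mpoly K[n]} :=
  \sum_(m : 'X_{1..n < D}) u`_(kwgt m) *: 'X_[m].

Lemma digits_inj k (f g : nat -> nat) : (forall j, f j < D)%N -> (forall j, g j < D)%N ->
  (\sum_(j < k) f j * D ^ j = \sum_(j < k) g j * D ^ j)%N -> forall j, (j < k)%N -> f j = g j.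
Proof.
elim: k f g => // k IHk f g fD gD; rewrite !big_ord_recl /= expn0 !muln1.
have E (h : nat -> nat) : (\sum_(i < k) h (bump 0 i) * D ^ bump 0 i = D * \sum_(i < k) h i.+1 * D ^ i)%N.
  by rewrite big_distrr; apply: eq_bigr => i _; rewrite /bump /= add1n expnS mulnCA.
rewrite !E => Efg.
have D0 : (0 < D)%N by apply: leq_trans (fD 0%N).
have E0 : f 0%N = g 0%N.
  have := congr1 (fun x => x %% D)%N Efg.
  by rewrite !(addnC (_ 0%N)) ![(D * _)%N]mulnC !modnMDl !modn_small.
case=> [|j] jk //; apply: (IHk (f \o S) (g \o S)) => //=.
by move: Efg; rewrite E0 => /addnI/eqP; rewrite eqn_pmul2l // => /eqP.
Qed.

Lemma kwgt_inj (m m' : 'X_{1..n}) : (mdeg m < D)%N -> (mdeg m' < D)%N ->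
  kwgt m = kwgt m' -> m = m'.
Proof.
move=> mD mD' E.
have lt (m0 : 'X_{1..n}) j : (mdeg m0 < D)%N -> (nth 0 m0 j < D)%N.
  move=> H; have [jn|nj] := ltnP j n; last by rewrite nth_default ?size_tuple //; apply: leq_trans H.
  apply: leq_ltn_trans H; rewrite mdegE (bigD1 (Ordinal jn)) //= (mnm_nth 0) leq_addr //.
apply/mnmP => j; rewrite !(mnm_nth 0).
apply: (@digits_inj n (fun j => nth 0%N m j) (fun j => nth 0%N m' j)) => // [k|k|].
- exact: lt.
- exact: lt.
by move: E; rewrite /kwgt; under eq_bigr do rewrite (mnm_nth 0); under [RHS]eq_bigr do rewrite (mnm_nth 0).
Qed.

Lemma kron_monomial (K : comNzRingType) (c : K) m : kron (c *: 'X_[m]) = c *: 'X^(kwgt m).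
Proof.
rewrite /kron mmapZ mmapX mul_polyC /mmap1 /kwgt; congr (_ *: _).
elim/big_rec2: _ => [|j a b _ ->]; first by rewrite expr0.
by rewrite exprD -exprM mulnC.
Qed.

Lemma coef_kron (K : comNzRingType) (p : {mpoly K[n]}) m :
  (msize p <= D)%N -> (mdeg m < D)%N -> (kron p)`_(kwgt m) = p@_m.
Proof.
move=> pD mD; rewrite {1}[p]mpolyE rmorph_sum coef_sum [RHS](_ : _ = (\sum_(m' <- msupp p) p@_m' *: 'X_[m'])@_m); last by rewrite -mpolyE.
rewrite raddf_sum /= big_seq [RHS]big_seq; apply: eq_bigr => m' m'p.
rewrite kron_monomial coefZ coefXn mcoeffZ mcoeffX; congr (_ * _%:R).
have m'D : (mdeg m' < D)%N by apply: leq_trans (msize_mdeg_lt m'p) pD.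
congr nat_of_bool; apply/eqP/eqP => [/kwgt_inj|->//]; by move=> -> .
Qed.

Lemma kronK (K : comNzRingType) (p : {mpoly K[n]}) : (msize p <= D)%N -> unkron (kron p) = p.
Proof.
move=> pD; rewrite [RHS](mpolywE pD); apply: eq_bigr => m _.
by rewrite coef_kron // bmdeg.
Qed.

Lemma map_unkron (K L : comNzRingType) (h : {rmorphism K -> L}) (u : {poly K}) :
  map_mpoly h (unkron u) = unkron (map_poly h u).
Proof.
rewrite rmorph_sum; apply: eq_bigr => m _.
by rewrite /= map_mpolyZ /= map_mpolyX coef_map.
Qed.

Lemma map_kron (K L : comNzRingType) (h : {rmorphism K -> L}) (p : {mpoly K[n]}) :
  map_poly h (kron p) = kron (map_mpoly h p).
Proof.
apply: (@mpoly_rmorph_eq _ _ _ (map_poly h \o @kron K) (@kron L \o map_mpoly h)) => [c|j] /=.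
  by rewrite map_mpolyC /kron !mmapC map_polyC.
by rewrite map_mpolyX /kron !mmapX !mmap1U map_polyXn.
Qed.

Lemma unkronZ (K : comNzRingType) (c : K) u : unkron (c *: u) = c *: unkron u.
Proof. by rewrite /unkron scaler_sumr; apply: eq_bigr => m _; rewrite coefZ scalerA. Qed.

End Kronecker.

Lemma msize_mul_leq1 n (K : idomainType) (p q : {mpoly K[n]}) a b :
  (msize p <= a.+1)%N -> (msize q <= b.+1)%N -> (msize (p * q) <= (a + b).+1)%N.
Proof.
move=> pa qb; have [->|p0] := eqVneq p 0; first by rewrite mul0r msize0.
have [->|q0] := eqVneq q 0; first by rewrite mulr0 msize0.
rewrite msizeM //; lia.
Qed.

Section Spec.
Variable n : nat.

Definition spec1 (K : comNzRingType) (i : 'I_n) (t : K) : {mpoly K[n]} -> {mpoly K[n]} :=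
  comp_mpoly [tuple (if j == i then t%:MP else 'X_j) | j < n].
HB.instance Definition _ K i t := GRing.RMorphism.on (@spec1 K i t).

Lemma spec1C (K : comNzRingType) i (t : K) c : spec1 i t c%:MP = c%:MP.
Proof. by rewrite /spec1 comp_mpolyC. Qed.

Lemma spec1X (K : comNzRingType) i (t : K) j :
  spec1 i t 'X_j = if j == i then t%:MP else 'X_j.
Proof. by rewrite /spec1 comp_mpolyXU -tnth_nth tnth_mktuple. Qed.

Lemma spec1Z (K : comNzRingType) i (t : K) c p : spec1 i t (c *: p) = c *: spec1 i t p.
Proof. by rewrite -!mul_mpolyC rmorphM /= spec1C. Qed.

Lemma spec1_id (K : comNzRingType) i (t : K) p : spec1 i t (spec1 i t p) = spec1 i t p.
Proof.
apply: (@mpoly_rmorph_eq _ _ _ (@spec1 K i t \o @spec1 K i t) (@spec1 K i t)) => [c|j] /=.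
  by rewrite !spec1C.
by rewrite spec1X; case: ifP => [_|ji]; rewrite ?spec1C // spec1X ji.
Qed.

Lemma msize_comp_le (K : idomainType) k (g : {mpoly K[n]}) (lq : n.-tuple {mpoly K[k]}) :
  (forall j, msize (tnth lq j) <= 2)%N -> (msize (g \mPo lq) <= msize g)%N.
Proof.
move=> Hlq; rewrite /comp_mpoly /mmap.
apply: (leq_trans (msize_sum _ _ _)); apply/bigmax_leqP_seq => m m_in _.
apply: leq_trans (msize_mdeg_lt m_in).
rewrite mul_mpolyC; apply: leq_trans (msizeZ_le _ _) _.
rewrite /mmap1 mdegE; elim/big_ind2: _ => //; first by rewrite msize1.
  by move=> p1 a1 p2 a2; apply: msize_mul_leq1.
move=> j _; elim: (m j) => [|e IHe]; first by rewrite expr0 msize1.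
by rewrite exprS; apply: (@msize_mul_leq1 _ _ _ _ 1 e).
Qed.
End Spec.

(** * Gauss's lemma *)

Section Gauss.
Variables (n : nat) (i : 'I_n).

(** Moves X_i into the coefficients as the polynomial variable T; the ring keeps n variables, X_i no
    longer occurring. Evaluating T at X_i, which is [substT], undoes this. *)
Definition genT (K : comNzRingType) : {mpoly K[n]} -> {mpoly {poly K}[n]} :=
  mmap (@mpolyC n {poly K} \o polyC) (fun j => if j == i then 'X%:MP else 'X_j).
HB.instance Definition _ K := GRing.RMorphism.on (@genT K).

Definition substT (K : comNzRingType) : {mpoly {poly K}[n]} -> {mpoly K[n]} :=
  mmap (horner_eval ('X_i : {mpoly K[n]}) \o map_poly (@mpolyC n K)) (fun j => 'X_j).
HB.instance Definition _ K := GRing.RMorphism.on (@substT K).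

Lemma genTC (K : comNzRingType) (c : K) : genT c%:MP = c%:P%:MP.
Proof. by rewrite /genT mmapC. Qed.

Lemma genTX (K : comNzRingType) j : @genT K 'X_j = if j == i then 'X%:MP else 'X_j.
Proof. by rewrite /genT mmapX mmap1U. Qed.

Lemma substTC (K : comNzRingType) (c : {poly K}) : substT c%:MP = (map_poly (@mpolyC n K) c).['X_i].
Proof. by rewrite /substT mmapC. Qed.

Lemma substTX (K : comNzRingType) j : @substT K 'X_j = 'X_j.
Proof. by rewrite /substT mmapX mmap1U. Qed.

Lemma genTK (K : comNzRingType) (f : {mpoly K[n]}) : substT (genT f) = f.
Proof.
apply: (@mpoly_rmorph_eq _ _ _ (@substT K \o @genT K) idfun) => [c|j] /=.
  by rewrite genTC substTC map_polyC hornerC.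
by rewrite genTX; case: eqP => [->|_]; rewrite ?substTC ?substTX // map_polyX hornerX.
Qed.

Lemma map_genT_horner (K : comNzRingType) t (f : {mpoly K[n]}) :
  map_mpoly (horner_eval t) (genT f) = spec1 i t f.
Proof.
apply: (@mpoly_rmorph_eq _ _ _ (map_mpoly (horner_eval t) \o @genT K) (@spec1 n K i t)) => [c|j] /=.
  by rewrite genTC map_mpolyC /= /horner_eval hornerC spec1C.
rewrite genTX spec1X; case: eqP => _; first by rewrite map_mpolyC /= /horner_eval hornerX.
by rewrite map_mpolyX.
Qed.

Lemma spec1_substT (K : comNzRingType) t (a : {mpoly {poly K}[n]}) :
  spec1 i t (substT a) = spec1 i t (map_mpoly (horner_eval t) a).
Proof.
apply: (@mpoly_rmorph_eq _ _ _ (@spec1 n K i t \o @substT K)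
   (@spec1 n K i t \o map_mpoly (horner_eval t))) => [c|j] /=.
  rewrite substTC map_mpolyC /= /horner_eval spec1C -horner_map /= -map_poly_comp.
  rewrite spec1X eqxx (eq_map_poly (_ : _ =1 @mpolyC n K)) ?horner_map // => x /=.
  by rewrite spec1C.
by rewrite substTX map_mpolyX.
Qed.

Lemma map_genT (K L : comNzRingType) (h : {rmorphism K -> L}) (f : {mpoly K[n]}) :
  map_mpoly (map_poly h) (genT f) = genT (map_mpoly h f).
Proof.
apply: (@mpoly_rmorph_eq _ _ _ (map_mpoly (map_poly h) \o @genT K) (@genT L \o map_mpoly h)) => [c|j] /=.
  by rewrite genTC !map_mpolyC /= genTC map_polyC.
rewrite genTX map_mpolyX genTX; case: eqP => _; last by rewrite map_mpolyX.
by rewrite map_mpolyC /= map_polyX.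
Qed.

Lemma dvdp_coefs_factor (K : fieldType) (q : {poly K}) (a : {mpoly {poly K}[n]}) :
  (forall m, q %| a@_m) -> exists a', a = q *: a'.
Proof.
move=> qa; exists (\sum_(m <- msupp a) (a@_m %/ q) *: 'X_[m]).
rewrite {1}[a]mpolyE scaler_sumr; apply: eq_bigr => m _.
by rewrite scalerA mulrC divpK.
Qed.

Lemma msize_spec1_le (K : idomainType) t (g : {mpoly K[n]}) : (msize (spec1 i t g) <= msize g)%N.
Proof.
apply: msize_comp_le => j; rewrite tnth_mktuple; case: eqP => _; last by rewrite msizeX mdeg1.
by rewrite msizeC; case: eqP.
Qed.

(* If r has a root tau, one of the two factors vanishes at T = tau, and the
   minimal polynomial of tau can be cancelled; if r is constant, put T = X_i. *)
Lemma gauss_irreducible (f : {mpoly rat[n]}) (t : rat) (r : {poly rat}) (a b : {mpoly {poly rat}[n]}) :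
    irreducible_Q f -> r != 0 -> r *: genT f = a * b ->
    (1 < msize (spec1 i t (map_mpoly (horner_eval t) a)))%N ->
    (1 < msize (spec1 i t (map_mpoly (horner_eval t) b)))%N ->
  False.
Proof.
move=> [sf irr_f]; have [k] := ubnP (size r); elim: k r a b => // k IHk r a b.
rewrite ltnS => rk r0 E sa sb.
have [r1|r1] := leqP (size r) 1%N.
  have [c c0 Er] : exists2 c, c != 0 & r = c%:P.
    exists r`_0; last exact: size1_polyC.
    by apply: contraNneq r0 => c0; rewrite [r]size1_polyC // c0.
  (* Replacing T by X_i and then X_i by t factors through the specialization at t, so the factors
     obtained over Q are at least as large as the specialized ones, hence nonconstant. *)
  have le_sub (p : {mpoly {poly rat}[n]}) :
      (msize (spec1 i t (map_mpoly (horner_eval t) p)) <= msize (substT p))%N.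
    by rewrite -spec1_substT; apply: msize_spec1_le.
  have c1 : c^-1 != 0 by rewrite invr_eq0.
  apply: irr_f; exists (c^-1 *: substT a), (substT b).
  split; first by rewrite (msizeZ _ c1); exact: leq_trans sa (le_sub a).
  split; first exact: leq_trans sb (le_sub b).
  have Eab : substT a * substT b = c *: f.
    rewrite -[LHS]rmorphM /= -E -[in LHS]mul_mpolyC rmorphM /= genTK substTC Er.
    by rewrite map_polyC hornerC mul_mpolyC.
  by rewrite -scalerAl Eab scalerA mulVf // scale1r.
have [tau rt] : exists tau : algC, root (map_poly ratr r) tau.
  by apply: closed_rootP; rewrite size_map_poly; case: (size r) r1 => [|[|]].
have [q [_ qm Hq]] := minCpolyP tau.
have qr : q %| r by rewrite -Hq.
have q1 : (1 < size q)%N.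
  rewrite -(size_map_poly (ratr : {rmorphism rat -> algC})); apply: (@root_size_gt1 _ tau).
    by rewrite map_poly_eq0 monic_neq0.
  by rewrite Hq.
have ev0 : map_mpoly (horner_eval tau \o map_poly ratr) a * map_mpoly (horner_eval tau \o map_poly ratr) b = 0 :> {mpoly algC[n]}.
  rewrite -rmorphM /= -E; apply/mpolyP => m; rewrite mcoeff_map_mpoly mcoeffZ mcoeff0 /=.
  by rewrite /horner_eval rmorphM /= hornerM (rootP rt) mul0r.
have dvd_of (c : {mpoly {poly rat}[n]}) : map_mpoly (horner_eval tau \o map_poly ratr) c = 0 :> {mpoly algC[n]} ->
   exists c', c = q *: c'.
  move=> c0; apply: dvdp_coefs_factor => m; rewrite -Hq; apply/rootP.
  by have := congr1 (mcoeff m) c0; rewrite mcoeff_map_mpoly mcoeff0.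
have [r' Er] : exists r', r = q * r'.
  by exists (r %/ q); rewrite mulrC divpK.
have q0 : q != 0 by apply: monic_neq0.
have r'0 : r' != 0 by apply: contraNneq r0 => r'0; rewrite Er r'0 mulr0.
have sr' : (size r' < k)%N.
  apply: leq_trans rk; rewrite Er size_mul //.
  by case: (size q) q1 => [|[|sq]] // _; rewrite !addSn /= ltnS leq_addl.
have qMP0 : q%:MP_[n] != 0 by rewrite mpolyC_eq0.
(* Dividing a factor by q divides its specialization by the scalar q(t), so the remaining factor is
   still nonconstant at t. *)
have evZ (c : {mpoly {poly rat}[n]}) :
  (msize (spec1 i t (map_mpoly (horner_eval t) (q *: c)))
    <= msize (spec1 i t (map_mpoly (horner_eval t) c)))%N.
  by rewrite map_mpolyZ spec1Z; apply: msizeZ_le.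
move/eqP: ev0; rewrite mulf_eq0 => /orP[] /eqP/dvd_of[c' Ec].
  apply: (IHk r' c' b sr' r'0 _ _ sb); last by apply: leq_trans sa _; rewrite Ec; apply: evZ.
  by apply: (mulfI qMP0); rewrite mulrA !mul_mpolyC scalerA -Er E Ec.
apply: (IHk r' a c' sr' r'0 _ sa); last by apply: leq_trans sb _; rewrite Ec; apply: evZ.
by apply: (mulfI qMP0); rewrite mulrCA !mul_mpolyC scalerA -Er E Ec.
Qed.

End Gauss.

(** * One residue class *)

Arguments evT : simpl never.

Lemma size_roots_evT (P : {poly int}) (ts : seq rat) : P != 0 -> uniq ts ->
  (forall t, t \in ts -> evT t P = 0) -> (size ts < size P)%N.
Proof.
move=> P0 uts Hts; have inj : injective (intr : int -> rat) by apply: intr_inj.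
rewrite -(size_map_inj_poly inj) //; apply: max_poly_roots => //.
  by rewrite -size_poly_eq0 size_map_inj_poly // size_poly_eq0.
by apply/allP => t /Hts; rewrite evTE => /eqP.
Qed.

(** * Degrees in T of the coefficients *)

Section DegT.
Variable n : nat.
Definition degT_le (k : nat) (p : {mpoly {poly int}[n]}) := forall m, (size (p@_m)%R <= k.+1)%N.

Lemma degT_leW k l p : (k <= l)%N -> degT_le k p -> degT_le l p.
Proof. by move=> kl Hp m; apply: leq_trans (Hp m) _. Qed.

Lemma degT_leN k p : degT_le k p -> degT_le k (- p).
Proof. by move=> Hp m; rewrite mcoeffN size_polyN. Qed.

Lemma degT_leD k p q : degT_le k p -> degT_le k q -> degT_le k (p + q).
Proof.
move=> Hp Hq m; rewrite mcoeffD; apply: leq_trans (size_polyD _ _) _.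
by rewrite geq_max Hp Hq.
Qed.

Lemma degT_le_sum (I : Type) (s : seq I) (P : pred I) (F : I -> {mpoly {poly int}[n]}) k :
  (forall x, P x -> degT_le k (F x)) -> degT_le k (\sum_(x <- s | P x) F x).
Proof.
move=> HF; elim/big_ind: _ => //; last by move=> p q; apply: degT_leD.
by move=> m; rewrite mcoeff0 size_poly0.
Qed.

Lemma degT_leM k l p q : degT_le k p -> degT_le l q -> degT_le (k + l) (p * q).
Proof.
move=> Hp Hq m; rewrite mcoeffM; apply: leq_trans (size_sum _ _ _) _.
by apply/bigmax_leqP => x _; apply: size_mul_leq1.
Qed.

Lemma degT_leC k (c : {poly int}) : (size c <= k.+1)%N -> degT_le k c%:MP.
Proof.
by move=> sc m; rewrite mcoeffC; case: eqP => _; rewrite ?mulr1 // mulr0 size_poly0.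
Qed.

Lemma degT_leZ k l (c : {poly int}) p : (size c <= k.+1)%N -> degT_le l p -> degT_le (k + l) (c *: p).
Proof. by move=> sc Hp; rewrite -mul_mpolyC; apply: degT_leM => //; apply: degT_leC. Qed.

Lemma degT_leX m : degT_le 0 'X_[m].
Proof. by move=> m'; rewrite mcoeffX; case: eqP; rewrite ?size_poly1 ?size_poly0. Qed.

Lemma degT_le_genT i (f : {mpoly int[n]}) d : (msize f <= d)%N -> degT_le d (genT i f).
Proof.
move=> sf; rewrite /genT mmap_sumE big_seq; apply: degT_le_sum => m m_in.
apply: degT_leW (leq_trans (ltnW (msize_mdeg_lt m_in)) sf) _.
rewrite -[mdeg m]add0n; apply: degT_leM; first by apply: degT_leC; apply: size_polyC_leq1.
rewrite mdegE /mmap1; elim/big_ind2: _ => //.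
- by apply: degT_leC; rewrite size_poly1.
- by move=> p a q b; apply: degT_leM.
move=> j _; elim: (m j) => [|e IHe]; first by rewrite expr0; apply: degT_leC; rewrite size_poly1.
rewrite exprS -add1n; apply: degT_leM => //; case: ifP => _.
  by apply: degT_leC; rewrite size_polyX.
exact: degT_leW (degT_leX _).
Qed.

Lemma degT_le_unkron D k (U : {poly {poly int}}) : (forall j, size (U`_j)%R <= k.+1)%N ->
  degT_le k (@unkron n D _ U).
Proof.
move=> HU; apply: degT_le_sum => m _; rewrite -[k]addn0; apply: degT_leZ => //.
exact: degT_leX.
Qed.

End DegT.

Lemma size_prod_leq1 (I : Type) (s : seq I) (P : pred I) (F : I -> {poly int}) d :
  (forall x, (size (F x) <= d.+1)%N) -> (size (\prod_(x <- s | P x) F x)%R <= (size s * d).+1)%N.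
Proof.
move=> HF; elim: s => [|x s IHs]; first by rewrite big_nil size_poly1.
rewrite big_cons /= mulSn; case: ifP => _; first exact: size_mul_leq1.
by apply: leq_trans IHs _; rewrite ltnS leq_addl.
Qed.

Lemma size_prod_ord_leq1 M (P : pred 'I_M) (F : 'I_M -> {poly int}) d :
  (forall x, (size (F x) <= d.+1)%N) -> (size (\prod_(x | P x) F x)%R <= (M * d).+1)%N.
Proof.
move=> HF; apply: leq_trans (size_prod_leq1 _ P HF) _.
by rewrite /index_enum -enumT -cardT card_ord.
Qed.

Lemma class_bound n (f : {mpoly int[n]}) (i : 'I_n) (D d del N : nat) (c : {poly int})
    (ts : seq rat) (z : rat -> 'I_(N.+1 + N.+1) -> rat) (A0 A1 : 'I_(N.+1 + N.+1) -> {poly int}) :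
  let u t : {poly rat} := \poly_(j < N.+1) z t (lshift _ (inord j)) in
  let w t : {poly rat} := \poly_(j < N.+1) z t (rshift _ (inord j)) in
  irreducible_Q (toQ f) -> (msize f <= d)%N -> (size c <= d.+1)%N -> uniq ts ->
  (forall t, t \in ts -> [/\ evT t c != 0,
     map_mpoly (evT t) (genT i f) = evT t c *: (unkron n D (u t) * unkron n D (w t)),
     (1 < msize (spec1 i t (unkron n D (u t))))%N &
     (1 < msize (spec1 i t (unkron n D (w t))))%N]) ->
  (forall j, [/\ (A0 j != 0) || (A1 j != 0), (size (A0 j) <= del.+1)%N, (size (A1 j) <= del.+1)%N
     & forall t, t \in ts -> evT t (A0 j) + evT t (A1 j) * z t j = 0]) ->
  (size ts <= 3 * (N.+1 + N.+1).+1 * del + d)%N.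
Proof.
move=> u w irr sf sc uts Hts HA; set M := (N.+1 + N.+1)%N in z A0 A1 u w Hts HA *.
(* If some [A1 j] is zero, then [A0 j] is nonzero and vanishes at every point of the class, so there
   are at most [del] points. *)
have [/existsP[j /eqP A1j]|nA1] := boolP [exists j, A1 j == 0].
  have [] := HA j; rewrite A1j eqxx orbF => A0j sA0 _ rel.
  have : (size ts < size (A0 j))%N.
    by apply: size_roots_evT => // t /rel; rewrite rmorph0 mul0r addr0.
  move=> H; apply: leq_trans (_ : del <= _)%N; first by rewrite -ltnS; apply: leq_trans sA0.
  nia.
have {nA1} A1_neq0 j : A1 j != 0 by move: nA1; rewrite negb_exists => /forallP.
(* A common denominator of the rational functions -A0_j/A1_j; [ut j] is the numerator of z_j over
   it. *)
pose Pi := \prod_j A1 j.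
have Pi0 : Pi != 0 by apply/prodf_neq0 => j _.
have sPi : (size Pi <= (M * del).+1)%N.
  by apply: size_prod_ord_leq1 => j; case: (HA j).
pose ut j := - A0 j * \prod_(k | k != j) A1 k.
have sut j : (size (ut j) <= (M.+1 * del).+1)%N.
  rewrite mulSn; apply: size_mul_leq1; first by rewrite size_polyN; case: (HA j).
  by apply: size_prod_ord_leq1 => k; case: (HA k).
have Eut t j : t \in ts -> evT t (ut j) = evT t Pi * z t j.
  move=> t_in; have [_ _ _ /(_ t t_in)/eqP] := HA j; rewrite addr_eq0 => /eqP E.
  have -> : evT t Pi = evT t (A1 j) * evT t (\prod_(k | k != j) A1 k).
    by rewrite /Pi (bigD1 j isT) rmorphM.
  have -> : evT t (ut j) = - evT t (A0 j) * evT t (\prod_(k | k != j) A1 k).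
    by rewrite /ut rmorphM rmorphN.
  by rewrite E; ring.
pose U : {poly {poly int}} := \poly_(j < N.+1) ut (lshift _ (inord j)).
pose W : {poly {poly int}} := \poly_(j < N.+1) ut (rshift _ (inord j)).
(* The factorization over Q(T) with denominators cleared: it holds at the points of the class, and
   too many points force it identically. *)
pose E := Pi ^+ 2 *: genT i f - c *: (unkron n D U * unkron n D W).
have degE : degT_le (2 * M.+1 * del + d) E.
  apply: degT_leD.
    apply: (@degT_leW _ (2 * (M * del) + d)); first by nia.
    by apply: degT_leZ; [apply: size_exp_leq1|apply: degT_le_genT].
  apply: degT_leN; apply: (@degT_leW _ (d + (M.+1 * del + M.+1 * del))); first by nia.
  apply: degT_leZ => //; apply: degT_leM; apply: degT_le_unkron => j;
    rewrite coef_poly; case: ifP; rewrite ?size_poly0 //.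
have mapU t : t \in ts -> map_mpoly (evT t) (unkron n D U) = evT t Pi *: unkron n D (u t).
  move=> t_in; rewrite map_unkron -unkronZ; congr (unkron _ _ _).
  by apply/polyP => j; rewrite coef_map coefZ !coef_poly /=; case: ifP => _; rewrite ?rmorph0 ?mulr0 ?Eut.
have mapW t : t \in ts -> map_mpoly (evT t) (unkron n D W) = evT t Pi *: unkron n D (w t).
  move=> t_in; rewrite map_unkron -unkronZ; congr (unkron _ _ _).
  by apply/polyP => j; rewrite coef_map coefZ !coef_poly /=; case: ifP => _; rewrite ?rmorph0 ?mulr0 ?Eut.
have mapE t : t \in ts -> map_mpoly (evT t) E = 0.
  move=> t_in; have [_ H _ _] := Hts t t_in.
  have -> : map_mpoly (evT t) E = evT t Pi ^+ 2 *: map_mpoly (evT t) (genT i f) -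
      evT t c *: (map_mpoly (evT t) (unkron n D U) * map_mpoly (evT t) (unkron n D W)).
    rewrite rmorphB; congr (_ - _); rewrite /= map_mpolyZ; congr (_ *: _).
      exact: (rmorphXn (evT t)).
    exact: (rmorphM (map_mpoly (evT t))).
  rewrite mapU // mapW // H.
  by rewrite -scalerAl -scalerAr !scalerA; apply/eqP; rewrite subr_eq0; apply/eqP; congr (_ *: _); ring.
(* Zeros of [Pi] are split off because Gauss's lemma needs one point where the interpolated factors
   remain nonconstant. The factor 3 in the bound covers M * del such zeros and the degree of [E]. *)
rewrite -(count_predC (fun t => evT t Pi == 0)) -!size_filter.
have le1 : (size [seq t <- ts | evT t Pi == 0%R] <= M * del)%N.
  rewrite -ltnS; apply: leq_trans sPi; apply: size_roots_evT => //; first exact: filter_uniq.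
  by move=> t; rewrite mem_filter => /andP[/eqP].
set ts3 := filter _ _; set ts4 := filter (predC _) _.
suff le2 : (size ts4 <= 2 * M.+1 * del + d)%N by move: le1; rewrite -/ts3; nia.
rewrite leqNgt; apply/negP => gt2.
have E0 : E = 0.
  apply/mpolyP => m; rewrite mcoeff0; apply/eqP; apply: contraT => Em.
  have : (size ts4 < size E@_m)%N.
    apply: size_roots_evT => //; first exact: filter_uniq.
    move=> t; rewrite mem_filter => /andP[_ /mapE/(congr1 (mcoeff m))].
    by rewrite mcoeff_map_mpoly mcoeff0.
  by move/leq_trans => /(_ _ (degE m)); rewrite ltnS leqNgt gt2.
have [t t4] : exists t, t \in ts4.
  by case: (ts4) gt2 => // t s _; exists t; rewrite mem_head.
move: t4; rewrite mem_filter /= => /andP[Pit t_in].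
have [ct _ mu mw] := Hts t t_in.
pose toR := map_poly (intr : int -> rat).
have ev_toR (p : {mpoly {poly int}[n]}) : map_mpoly (horner_eval t) (map_mpoly toR p) = map_mpoly (evT t) p.
  by apply/mpolyP => m; rewrite !mcoeff_map_mpoly.
have r0 : toR (Pi ^+ 2) != 0.
  by rewrite -size_poly_eq0 size_map_inj_poly ?size_poly_eq0 ?expf_neq0 //; apply: intr_inj.
have EQ : toR (Pi ^+ 2) *: genT i (toQ f) =
    map_mpoly toR (c *: unkron n D U) * map_mpoly toR (unkron n D W).
  rewrite -(rmorphM (map_mpoly toR)) -scalerAl.
  have -> : c *: (unkron n D U * unkron n D W) = Pi ^+ 2 *: genT i f.
    by apply/esym/eqP; rewrite -subr_eq0 -/E E0.
  by rewrite [RHS](map_mpolyZ (map_poly (intr : int -> rat))) /toQ -map_genT.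
apply: (gauss_irreducible (t := t) irr r0 EQ).
  have -> : spec1 i t (map_mpoly (horner_eval t) (map_mpoly toR (c *: unkron n D U))) =
      (evT t c * evT t Pi) *: spec1 i t (unkron n D (u t)).
    rewrite ev_toR -spec1Z -scalerA -(mapU t t_in); congr (spec1 _ _ _).
    exact: (map_mpolyZ (evT t)).
  have cPi : evT t c * evT t Pi != 0 by exact: mulf_neq0.
  rewrite (msizeZ _ cPi); exact: mu.
have -> : spec1 i t (map_mpoly (horner_eval t) (map_mpoly toR (unkron n D W))) =
    evT t Pi *: spec1 i t (unkron n D (w t)).
  by rewrite ev_toR (mapW t t_in) spec1Z.
rewrite (msizeZ _ Pit); exact: mw.
Qed.

(** * Specializing one variable *)

(* Md and CU govern the degree and the coefficients of R in terms of those of F. *)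
Definition has_resolvent (m Md CU : nat) (F : {poly {poly int}}) : Prop :=
  exists R : {poly {poly int}}, [/\ (size R <= m.+1)%N,
    forall d, (forall j, size (F`_j)%R <= d.+1)%N ->
       forall k, (size (R`_k)%R <= (Md * d).+1)%N,
    forall H, (0 < H)%N -> (forall j, l1norm (F`_j)%R <= H)%N ->
       forall k i, (`|(R`_k`_i)%R| <= CU * H ^ Md)%N
    & forall t, evT t F`_(size F).-1 != 0 -> map_poly (evT t) R != 0 /\
        forall u v : {poly rat}, u \is monic -> map_poly (evT t) F = u * v ->
        forall j : 'I_(size F).-1.+1, (map_poly (evT t) R).[u`_j] = 0 ].

Lemma has_resolventW m Md CU m' Md' CU' F : (m <= m')%N -> (Md <= Md')%N -> (CU <= CU')%N ->
  has_resolvent m Md CU F -> has_resolvent m' Md' CU' F.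
Proof.
move=> mm MM CC [R [sR sRk HR Rt]]; exists R; split=> //.
- exact: leq_trans sR _.
- move=> d Hd k; apply: leq_trans (sRk d Hd k) _; by rewrite ltnS leq_mul2r MM orbT.
move=> H H0 HF k i; apply: leq_trans (HR H H0 HF k i) _.
by apply: leq_mul => //; apply: leq_pexp2l.
Qed.

(** The degree of the Kronecker image varies with f but is bounded, so maxima over the possible
    degrees give constants independent of f. *)
Lemma resolvent_uniform N0 : exists m Md CU : nat,
  forall F : {poly {poly int}}, F != 0 -> (size F <= N0.+1)%N -> has_resolvent m Md CU F.
Proof.
elim: N0 => [|N0 [m [Md [CU IH]]]].
  have [m [Md [CU H]]] := resolvent_exists 0; exists m, Md, CU => F F0 sF.
  have sF1 : size F = 1%N by apply/eqP; rewrite eqn_leq sF size_poly_gt0.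
  by have := H F sF1; rewrite /has_resolvent sF1.
have [m' [Md' [CU' H]]] := resolvent_exists N0.+1.
exists (maxn m m'), (maxn Md Md'), (maxn CU CU') => F F0; rewrite leq_eqVlt => /orP[/eqP sF|sF].
  apply: (@has_resolventW m' Md' CU'); rewrite ?leq_maxr //.
  by have := H F sF; rewrite /has_resolvent sF.
by apply: (@has_resolventW m Md CU); rewrite ?leq_maxl //; apply: IH.
Qed.

Section KronBounds.
Variables (n : nat) (i : 'I_n) (D : nat).

Definition kwgtD (m : 'X_{1..n}) : nat := (\sum_(j < n | j != i) D ^ j * m j)%N.

Lemma kron_genT_sum (f : {mpoly int[n]}) :
  kron D (genT i f) = \sum_(m <- msupp f) ((f@_m)%:P * 'X^(m i))%:P * 'X^(kwgtD m).
Proof.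
transitivity (mmap (@polyC _ \o @polyC int) (fun j : 'I_n => if j == i then ('X : {poly int})%:P else 'X^(D ^ j)) f).
  apply: (@mpoly_rmorph_eq _ _ _ (@kron n D {poly int} \o @genT n i int)
     (mmap (@polyC _ \o @polyC int) (fun j : 'I_n => if j == i then ('X : {poly int})%:P else 'X^(D ^ j)))) => [c|j] /=.
    by rewrite genTC /kron !mmapC.
  by rewrite genTX [RHS]mmapX mmap1U; case: eqP => _; rewrite /kron ?mmapC ?mmapX ?mmap1U.
rewrite mmap_sumE; apply: eq_bigr => m _; rewrite /= polyCM -mulrA; congr (_ * _).
rewrite /mmap1 (bigD1 i) //= eqxx rmorphXn; congr (_ * _).
by rewrite /kwgtD -prodrXr; apply: eq_bigr => j /negbTE ->; rewrite exprM.
Qed.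

Lemma kwgtD_le (m : 'X_{1..n}) : (0 < D)%N -> (kwgtD m <= mdeg m * D ^ n)%N.
Proof.
move=> D0; rewrite /kwgtD mdegE big_distrl /= [X in (_ <= X)%N](bigID (fun j => j != i)) /=.
apply: leq_trans (leq_addr _ _); apply: leq_sum => j _; rewrite mulnC leq_mul2l.
by rewrite leq_pexp2l ?orbT // ltnW.
Qed.

Lemma size_msupp_le (f : {mpoly int[n]}) d : (msize f <= d)%N -> (size (msupp f) <= #|{: 'X_{1..n < d}}|)%N.
Proof.
move=> sf; rewrite cardT -(size_map (@bmnm n d)).
apply: uniq_leq_size; first exact: msupp_uniq.
move=> m m_in; have md : (mdeg m < d)%N by apply: leq_trans (msize_mdeg_lt m_in) sf.
by apply/mapP; exists (BMultinom md); rewrite ?mem_enum.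
Qed.

Lemma kron_genT_bounds (f : {mpoly int[n]}) d H : (0 < D)%N -> (msize f <= d)%N ->
    (forall m, `|(f@_m)%R| <= H)%N ->
  [/\ (size (kron D (genT i f)) <= (d * D ^ n).+1)%N,
      forall k, (size ((kron D (genT i f))`_k)%R <= d.+1)%N
    & forall k, (l1norm ((kron D (genT i f))`_k)%R <= #|{: 'X_{1..n < d}}| * H)%N].
Proof.
move=> D0 sf Hf; have mdle m : m \in msupp f -> (mdeg m <= d)%N.
  by move=> m_in; apply: ltnW; apply: leq_trans (msize_mdeg_lt m_in) sf.
have coefE k : (kron D (genT i f))`_k =
    \sum_(m <- msupp f) (f@_m)%:P * 'X^(m i) * (k == kwgtD m)%:R.
  by rewrite kron_genT_sum coef_sum; apply: eq_bigr => m _; rewrite coefCM coefXn.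
split.
- rewrite kron_genT_sum; apply: leq_trans (size_sum _ _ _) _.
  apply/bigmax_leqP_seq => m m_in _; apply: leq_trans (size_polyMleq _ _) _.
  rewrite size_polyXn; have := size_polyC_leq1 ((f@_m)%:P * 'X^(m i)).
  have := leq_trans (kwgtD_le m D0) (leq_mul (mdle m m_in) (leqnn (D ^ n))).
  by move: (size _) (kwgtD m) => a b; lia.
- move=> k; rewrite coefE; apply: leq_trans (size_sum _ _ _) _.
  apply/bigmax_leqP_seq => m m_in _; case: eqP => _; rewrite ?mulr0 ?size_poly0 // mulr1.
  rewrite -[d]add0n; apply: size_mul_leq1; first exact: size_polyC_leq1.
  rewrite size_polyXn ltnS; apply: leq_trans (mdle m m_in).
  by rewrite mdegE (bigD1 i) //= leq_addr.
move=> k; rewrite coefE; apply: leq_trans (l1norm_sum _ _) _.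
apply: (@leq_trans (\sum_(m <- msupp f) H)); last first.
  by rewrite big_const_seq count_predT iter_addn_0 mulnC leq_mul2r size_msupp_le ?orbT.
apply: leq_sum => m _; apply: leq_trans (_ : l1norm ((f@_m)%:P * 'X^(m i)) <= _)%N.
  by case: eqP => _; rewrite ?mulr1 // mulr0 /l1norm size_poly0 big_ord0.
apply: leq_trans (l1normCM _ _) _; apply: leq_trans (Hf m).
rewrite -[X in (_ <= X)%N]muln1 leq_mul2l; apply/orP; right.
elim: (m i : nat) => [|e IHe]; first by rewrite expr0 -polyC1 l1normC.
by rewrite exprSr -[_ * 'X]addr0 -polyC0 l1normMXD absz0 addn0.
Qed.

End KronBounds.

(* Unification would otherwise unfold these morphisms. *)
Opaque spec1 kron unkron genT.

Lemma msize_map_le n (K L : nzRingType) (h : {additive K -> L}) (p : {mpoly K[n]}) :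
  (msize (map_mpoly h p) <= msize p)%N.
Proof.
rewrite [X in (X <= _)%N]msizeE; apply/bigmax_leqP_seq => m m_in _.
apply: msize_mdeg_lt; move: m_in; rewrite !mcoeff_msupp mcoeff_map_mpoly.
by apply: contraNneq => ->; rewrite raddf0.
Qed.

Lemma map_mpoly_evT n t (p : {mpoly {poly int}[n]}) :
  map_mpoly (evT t) p = map_mpoly (horner_eval t) (map_mpoly (map_poly (intr : int -> rat)) p).
Proof. by apply/mpolyP => m; rewrite !mcoeff_map_mpoly. Qed.

Lemma map_evT_genT n (i : 'I_n) t (f : {mpoly int[n]}) :
  map_mpoly (evT t) (genT i f) = spec1 i t (toQ f).
Proof.
by rewrite -map_genT_horner /toQ -map_genT map_mpoly_evT.
Qed.

(* The factors of g may involve X_i; putting X_i = t in them does not change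
   their degrees, since the product is unchanged. *)
Lemma reducible_factor_data n (i : 'I_n) (D : nat) (t ct : rat) (g : {mpoly rat[n]}) (P : {poly rat}) :
  kron D g = P -> spec1 i t g = g -> (msize g <= D)%N -> lead_coef P = ct -> ct != 0 ->
  reducible_Q g ->
  exists uw : {poly rat} * {poly rat},
   [/\ (uw.1 \is monic) && (uw.2 \is monic),
     (exists v, P = uw.1 * v) /\ (exists v, P = uw.2 * v),
     (size uw.1 <= size P)%N /\ (size uw.2 <= size P)%N,
     g = ct *: (unkron n D uw.1 * unkron n D uw.2) &
     (1 < msize (spec1 i t (unkron n D uw.1)))%N /\
     (1 < msize (spec1 i t (unkron n D uw.2)))%N].
Proof.
move=> EP Eg1 sg lP ct0 [a [b [sa [sb Eg]]]].
have P0 : P != 0 by rewrite -lead_coef_eq0 lP.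
have g0 : g != 0 by apply: contraNneq P0 => g0; rewrite -EP g0 rmorph0.
have [a0 Ea0] : exists a0, a0 = spec1 i t a by exists (spec1 i t a); reflexivity.
have [b0 Eb0] : exists b0, b0 = spec1 i t b by exists (spec1 i t b); reflexivity.
have Eg0 : g = a0 * b0.
  rewrite Ea0 Eb0; transitivity (spec1 i t (a * b)); last exact: (rmorphM (spec1 i t)).
  by rewrite -Eg Eg1.
have a0_id : spec1 i t a0 = a0 by rewrite Ea0; exact: spec1_id.
have b0_id : spec1 i t b0 = b0 by rewrite Eb0; exact: spec1_id.
have sa0 : (msize a0 <= msize a)%N by rewrite Ea0; apply: msize_spec1_le.
have sb0 : (msize b0 <= msize b)%N by rewrite Eb0; apply: msize_spec1_le.
clear Ea0 Eb0.
have a0_neq0 : a0 != 0 by apply: contraNneq g0 => E; rewrite Eg0 E mul0r.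
have b0_neq0 : b0 != 0 by apply: contraNneq g0 => E; rewrite Eg0 E mulr0.
have a_neq0 : a != 0 by apply: contraNneq g0 => E; rewrite Eg E mul0r.
have b_neq0 : b != 0 by apply: contraNneq g0 => E; rewrite Eg E mulr0.
have E1 : (msize g = (msize a + msize b).-1)%N by rewrite Eg msizeM.
have E2 : (msize g = (msize a0 + msize b0).-1)%N by rewrite Eg0 msizeM.
have a0_gt1 : (1 < msize a0)%N.
  by move: E1 E2 sa sb sa0 sb0; move: (msize g) (msize a) (msize b) (msize a0) (msize b0); clear; lia.
have b0_gt1 : (1 < msize b0)%N.
  by move: E1 E2 sa sb sa0 sb0; move: (msize g) (msize a) (msize b) (msize a0) (msize b0); clear; lia.
have a0D : (msize a0 <= D)%N.
  by move: sg E2 b0_gt1; move: (msize g) (msize a0) (msize b0); clear; lia.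
have b0D : (msize b0 <= D)%N.
  by move: sg E2 a0_gt1; move: (msize g) (msize a0) (msize b0); clear; lia.
have Ek : kron D a0 * kron D b0 = P by rewrite -EP Eg0 rmorphM.
have ka : kron D a0 != 0 by apply: contraNneq P0 => E; rewrite -Ek E mul0r.
have kb : kron D b0 != 0 by apply: contraNneq P0 => E; rewrite -Ek E mulr0.
have [ua Eua] : exists ua, ua = kron D a0 by exists (kron D a0).
have [ub Eub] : exists ub, ub = kron D b0 by exists (kron D b0).
have Ka : unkron n D ua = a0 by rewrite Eua kronK.
have Kb : unkron n D ub = b0 by rewrite Eub kronK.
rewrite -Eua -Eub in Ek ka kb; clear Eua Eub.
pose al := lead_coef ua; pose be := lead_coef ub.
have al0 : al != 0 by rewrite lead_coef_eq0.
have be0 : be != 0 by rewrite lead_coef_eq0.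
have al1 : al^-1 != 0 by rewrite invr_eq0.
have be1 : be^-1 != 0 by rewrite invr_eq0.
have Eab : al * be = ct by rewrite -lead_coefM Ek lP.
exists (al^-1 *: ua, be^-1 *: ub); rewrite [_.1]/= [_.2]/=; split.
- by rewrite !monicE !lead_coefZ !mulVf ?eqxx.
- split; [exists (al *: ub)|exists (be *: ua)].
    by rewrite -Ek -scalerAl -scalerAr scalerA mulVf // scale1r.
  by rewrite -Ek -scalerAl -scalerAr scalerA mulVf // scale1r mulrC.
- rewrite !size_scale //; split; apply: dvdp_leq => //; rewrite -Ek; [exact: dvdp_mulr|exact: dvdp_mull].
- rewrite !unkronZ Ka Kb Eg0 -Eab -scalerAl -scalerAr !scalerA.
  by rewrite [X in X *: _](_ : _ = 1) ?scale1r //; field; rewrite al0 be0.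
rewrite !unkronZ Ka Kb !spec1Z a0_id b0_id.
by rewrite (msizeZ _ al1) (msizeZ _ be1).
Qed.

Lemma spec_factor_data n (f : {mpoly int[n]}) (i : 'I_n) (D : nat) (t : rat) :
  let F := kron D (genT i f) in let c := F`_(size F).-1 in
  (msize f <= D)%N -> evT t c != 0 -> reducible_Q (spec1 i t (toQ f)) ->
  exists uw : {poly rat} * {poly rat},
   [/\ (uw.1 \is monic) && (uw.2 \is monic),
     (exists v, map_poly (evT t) F = uw.1 * v) /\ (exists v, map_poly (evT t) F = uw.2 * v),
     (size uw.1 <= (size F).-1.+1)%N /\ (size uw.2 <= (size F).-1.+1)%N,
     map_mpoly (evT t) (genT i f) = evT t c *: (unkron n D uw.1 * unkron n D uw.2) &
     (1 < msize (spec1 i t (unkron n D uw.1)))%N /\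
     (1 < msize (spec1 i t (unkron n D uw.2)))%N].
Proof.
move=> F c sf ct red.
have lF : lead_coef (map_poly (evT t) F) = evT t c.
  by rewrite lead_coef_map_eq // lead_coefE.
have sF : size (map_poly (evT t) F) = size F.
  by rewrite size_map_poly_id0 // lead_coefE.
have F0 : map_poly (evT t) F != 0 by rewrite -lead_coef_eq0 lF.
have -> : (size F).-1.+1 = size (map_poly (evT t) F).
  by rewrite sF prednK // -sF size_poly_gt0.
have EF : kron D (spec1 i t (toQ f)) = map_poly (evT t) F by rewrite /F map_kron map_evT_genT.
have sg : (msize (spec1 i t (toQ f)) <= D)%N.
  apply: leq_trans (msize_spec1_le _ _ _) _; apply: leq_trans sf.
  exact: msize_map_le.
rewrite map_evT_genT; exact: (reducible_factor_data EF (spec1_id i t (toQ f)) sg lF ct red).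
Qed.

(** Absorbs constants into the exponent: every quantity is bounded by 2 to the power l times a
    constant, so its logarithm is linear in l. *)
Lemma const_le_exp c l : (0 < l)%N -> (c <= 2 ^ (l * c))%N.
Proof.
move=> l0; apply: leq_trans (ltnW (ltn_expl c (ltnSn 1))) _.
by rewrite leq_exp2l // leq_pmull.
Qed.

Lemma coef_derivn_bound (R : {poly {poly int}}) m B e k i :
  (size R <= m.+1)%N -> (forall k i, `|(R`_k`_i)%R| <= B)%N ->
  (`|(R^`(e)`_k`_i)%R| <= m`! * B)%N.
Proof.
move=> sR HR; rewrite coef_derivn.
have [le|lt] := leqP (size R) (e + k); first by rewrite coefMn (nth_default 0 le) coef0 mul0rn.
rewrite coefMn -mulr_natl abszM mulnC [X in (_ <= X)%N]mulnC; apply: leq_mul => //.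
rewrite natz absz_nat; have ekm : (e + k <= m)%N by rewrite -ltnS (leq_trans lt).
apply: leq_trans (_ : (e + k)`! <= _)%N; last exact: leq_fact.
by rewrite -(ffact_fact (leq_addr k e)) leq_pmulr // fact_gt0.
Qed.

(** The degree D of the auxiliary pair: with W <= 2^a, the choice D = a + 3 satisfies 2(D+1)W <
    4^D. *)
Definition delta_of l hW := (l * hW + 3)%N.

Lemma delta_of_lt l hW W : (W <= 2 ^ (l * hW))%N ->
  ((delta_of l hW).+1 * 2 * W < 4 ^ delta_of l hW)%N.
Proof.
rewrite /delta_of; move: (l * hW)%N => a Wa.
have E : (4 ^ (a + 3) = 2 ^ (a + 3) * (8 * 2 ^ a))%N.
  by rewrite (_ : 4 = 2 * 2)%N // expnMn; congr (_ * _)%N; rewrite expnD mulnC.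
rewrite E; have lt_a : (a < 2 ^ a)%N by apply: ltn_expl.
have E2 : (2 ^ (a + 3) = 8 * 2 ^ a)%N by rewrite expnD mulnC.
rewrite E2; move: (2 ^ a)%N Wa lt_a => x; nia.
Qed.

Section Count.
Variables (n d : nat).
Let D := d.+1.
Let N0 := (d * D ^ n)%N.
Let M0 := (N0.+1 + N0.+1)%N.

(** At these t the leading coefficient of F survives, so R(t, Z) is nonzero and has the coefficients
    of the monic factors as roots. The constants [hH], [hW], [hL] are exponents, per unit of l, for
    the coefficients of R and its derivatives, for the heights of the z_j, and for the integer that
    p avoids. *)
Lemma one_variable_good (m Md CU : nat) (f : {mpoly int[n]}) (i : 'I_n) (l b : nat) (ts : seq rat) :
    let F := kron D (genT i f) in
    let hH := (m`! * CU + (#|{: 'X_{1..n < d}}| + 2) * Md)%N in let d1 := (Md * d)%N in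
    let hW := (d1.+1 + hH + d1)%N in
    let hL := (1 + (hW + (d1.+1 * m.+1 + hH + d1 + hW * m)) * M0)%N in
    F != 0 -> has_resolvent m Md CU F ->
    irreducible_Q (toQ f) -> (msize f <= d)%N -> (forall m, `|(f@_m)%R| <= 2 ^ l)%N ->
    (0 < l)%N -> (0 < b)%N -> (b <= 2 ^ l)%N -> uniq ts ->
    (forall t, t \in ts -> [/\ (height t <= b)%N, evT t F`_(size F).-1 != 0 &
        reducible_Q (spec1 i t (toQ f))]) ->
  (size ts <= (16 * (l * hL + 1) ^ 2).+1 * (4 * b * (16 * (l * hL + 1) ^ 2)).+1 *
     (m * m).+1 ^ M0 * (3 * M0.+1 * delta_of l hW + d))%N.
Proof.
move=> F hH d1 hW hL F0 [R [sR sRk HR Rt]] irr sf Hf l0 b0 bl uts Hts.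
have D0 : (0 < D)%N by [].
have [sF sFk nFk] := kron_genT_bounds i D0 sf Hf.
rewrite -/F -/N0 in sF sFk nFk.
set N := (size F).-1 in Rt Hts.
have sFN : size F = N.+1 by rewrite prednK // size_poly_gt0.
have NN0 : (N <= N0)%N by rewrite -ltnS -sFN.
pose M := (N.+1 + N.+1)%N.
have MM0 : (M <= M0)%N by rewrite /M /M0; clear -NN0; lia.
have exuw t : t \in ts -> exists uw : {poly rat} * {poly rat},
   [/\ (uw.1 \is monic) && (uw.2 \is monic),
     (exists v, map_poly (evT t) F = uw.1 * v) /\ (exists v, map_poly (evT t) F = uw.2 * v),
     (size uw.1 <= N.+1)%N /\ (size uw.2 <= N.+1)%N,
     map_mpoly (evT t) (genT i f) = evT t F`_N *: (unkron n D uw.1 * unkron n D uw.2) &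
     (1 < msize (spec1 i t (unkron n D uw.1)))%N /\
     (1 < msize (spec1 i t (unkron n D uw.2)))%N].
  by move=> t_in; have [_ ct red] := Hts t t_in; apply: spec_factor_data => //; apply: leqW.
have [uw Huw] := seq_choice (0, 0) exuw.
pose z t (j : 'I_M) : rat := match split j with inl k => (uw t).1`_k | inr k => (uw t).2`_k end.
pose card := #|{: 'X_{1..n < d}}|.
pose H := (2 ^ (l * hH))%N; pose W := (2 ^ (l * hW))%N; pose L := (l * hL + 1)%N.
have HRc e k j : (`|(R^`(e)`_k`_j)%R| <= H)%N.
  have H0 : (0 < card.+1 * 2 ^ l)%N by rewrite muln_gt0 expn_gt0.
  apply: leq_trans (coef_derivn_bound _ _ _ sR (HR _ H0 _)) _.
    by move=> k'; apply: leq_trans (nFk k') _; rewrite leq_mul2r leqnSn orbT.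
  rewrite mulnA; apply: leq_trans (leq_mul (const_le_exp _ l0) (leq_exp2r_any Md (leq_mul (const_le_exp card.+1 l0) (leqnn _)))) _.
  rewrite -expnD -expnM -expnD leq_pexp2l // /hH -/card; clear; nia.
have HRc0 k j : (`|(R`_k`_j)%R| <= H)%N by have := HRc 0%N k j; rewrite derivn0.
have dk := sRk d sFk.
have Xd1 e : (b ^ e <= 2 ^ (l * e))%N by rewrite expnM; apply: leq_exp2r_any.
have root_z t j : t \in ts -> map_poly (evT t) R != 0 /\ (map_poly (evT t) R).[z t j] = 0.
  move=> t_in; have [_ ct _] := Hts t t_in; have [R0 Rroot] := Rt t ct; split=> //.
  have [/andP[um wm] [[v Ev] [v' Ev']] _ _ _] := Huw t t_in.
  by rewrite /z; case: split => k; [apply: (Rroot _ v)|apply: (Rroot _ v')].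
apply: leq_trans (@count_classes R M m d1 H L (delta_of l hW) b W
   (3 * M.+1 * delta_of l hW + d) ts z sR dk HRc b0 (delta_of_lt (leqnn _)) _ _ uts _ _) _.
- by rewrite /L addn1.
- rewrite /L; apply: (@leq_ltn_trans (2 ^ (l * hL))); last by rewrite ltn_exp2l // addn1.
  rewrite /hL mulnDr muln1 expnD; apply: leq_mul => //.
  set hI := (hW + _)%N; apply: (@leq_trans ((2 ^ (l * hI)) ^ M)).
    apply: leq_exp2r_any.
    have -> : (2 ^ (l * hI) = 2 ^ (l * hW) * (2 ^ (l * (d1.+1 * m.+1)) * 2 ^ (l * hH) *
        2 ^ (l * d1) * 2 ^ (l * (hW * m))))%N by rewrite -!expnD -!mulnDr.
    apply: leq_mul => //.
    have -> : (d1.+1 * m.+1 * (H * b ^ d1 * W ^ m) = d1.+1 * m.+1 * H * b ^ d1 * W ^ m)%N.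
      by rewrite !mulnA.
    apply: leq_mul; last by rewrite /W -expnM mulnA.
    by apply: leq_mul => //; apply: leq_mul => //; apply: const_le_exp.
  by rewrite -expnM leq_pexp2l // -mulnA leq_mul2l leq_mul2l MM0 !orbT.
- move=> t t_in; have [tb ct _] := Hts t t_in; split=> // j.
  have [R0 Rz] := root_z t j t_in; split=> //.
  apply: leq_trans (height_root_fiber dk HRc0 tb R0 Rz) _.
  have -> : W = (2 ^ (l * d1.+1) * (2 ^ (l * hH) * 2 ^ (l * d1)))%N.
    by rewrite -!expnD -!mulnDr addnA.
  by apply: leq_mul; [apply: const_le_exp|apply: leq_mul].
- move=> ts' A0 A1 uts' sub HA.
  apply: (@class_bound n f i D d (delta_of l hW) N F`_N ts' z A0 A1 irr sf (sFk N) uts' _ HA).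
  move=> t /sub t_in; have [_ ct _] := Hts t t_in.
  have [_ _ [su sw] E [mu mw]] := Huw t t_in.
  have -> : \poly_(j < N.+1) z t (lshift _ (inord j)) = (uw t).1.
    apply/polyP => j; rewrite coef_poly; case: ltnP => [lt_j|le_j]; last by rewrite nth_default // (leq_trans su).
    by rewrite /z (unsplitK (inl _)) inordK.
  have -> : \poly_(j < N.+1) z t (rshift _ (inord j)) = (uw t).2.
    apply/polyP => j; rewrite coef_poly; case: ltnP => [lt_j|le_j]; last by rewrite nth_default // (leq_trans sw).
    by rewrite /z (unsplitK (inr _)) inordK.
  split; [exact: ct|exact: E|exact: mu|exact: mw].
(* The power of m * m is not monotone in the exponent when m = 0, hence the successor in the
   base. *)
rewrite -/L; apply: leq_mul.
  rewrite leq_mul2l; apply/orP; right; apply: leq_trans (leq_exp2r_any _ (leqnSn _)) _.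
  exact: leq_pexp2l.
by rewrite leq_add2r leq_mul2r leq_mul2l ltnS MM0 !orbT.
Qed.

Lemma one_variable : exists C : nat,
  forall (f : {mpoly int[n]}) (i : 'I_n) (l b : nat) (ts : seq rat),
    irreducible_Q (toQ f) -> (msize f <= d)%N -> (forall m, `|(f@_m)%R| <= 2 ^ l)%N ->
    (0 < l)%N -> (0 < b)%N -> (b <= 2 ^ l)%N -> uniq ts ->
    (forall t, t \in ts -> (height t <= b)%N /\ reducible_Q (spec1 i t (toQ f))) ->
  (size ts <= C * b * l ^ 5)%N.
Proof.
have [m [Md [CU Hres]]] := resolvent_uniform N0.
pose hH := (m`! * CU + (#|{: 'X_{1..n < d}}| + 2) * Md)%N; pose d1 := (Md * d)%N.
pose hW := (d1.+1 + hH + d1)%N.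
pose hL := (1 + (hW + (d1.+1 * m.+1 + hH + d1 + hW * m)) * M0)%N.
pose K := ((m * m).+1 ^ M0)%N.
pose G := (3 * M0.+1 * (hW + 3) + d)%N.
exists (d + 17 * hL.+1 ^ 2 * (65 * hL.+1 ^ 2) * K * G)%N => f i l b ts irr sf Hf l0 b0 bl uts Hts.
case: ts uts Hts => [|t0 ts0] // uts Hts; set ts := t0 :: ts0 in uts Hts *.
pose F := kron D (genT i f).
(* A reducible polynomial is a product of nonconstant factors, hence nonzero, so one point of the
   list excludes F = 0. *)
have F0 : F != 0.
  apply/eqP => F0; have [_ [a [b' [sa [sb Eg]]]]] := Hts t0 (mem_head _ _).
  have g0 : spec1 i t0 (toQ f) = 0.
    rewrite -(@kronK n D _ (spec1 i t0 (toQ f))).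
      by rewrite -map_evT_genT -map_kron -/F F0 rmorph0 -(scale0r (0 : {poly rat})) unkronZ scale0r.
    apply: leq_trans (msize_spec1_le _ _ _) _; apply: leq_trans (leqW sf).
    exact: msize_map_le.
  have a0 : a != 0 by apply: contraTneq sa => ->; rewrite msize0.
  have b'0 : b' != 0 by apply: contraTneq sb => ->; rewrite msize0.
  have : a * b' != 0 by exact: mulf_neq0.
  by move/negP; apply; apply/eqP; rewrite -[LHS]Eg g0.
have [sF sFk _] := kron_genT_bounds i (ltn0Sn d) sf Hf.
set c := F`_(size F).-1.
have c0 : c != 0 by rewrite /c -lead_coefE lead_coef_eq0.
(* The at most d points where the leading coefficient vanishes are counted separately. *)
rewrite -(count_predC (fun t => evT t c == 0)) -!size_filter.
have le1 : (size [seq t <- ts | evT t c == 0%R] <= d)%N.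
  rewrite -ltnS; apply: leq_trans (sFk (size F).-1); apply: size_roots_evT => //.
    exact: filter_uniq.
  by move=> t; rewrite mem_filter => /andP[/eqP].
have le2 := @one_variable_good m Md CU f i l b [seq t <- ts | predC (fun t => evT t c == 0%R) t]
  F0 (Hres F F0 sF) irr sf Hf l0 b0 bl (filter_uniq _ uts).
rewrite -/hH -/d1 -/hW -/hL -/K in le2.
apply: leq_trans (leq_add le1 (le2 _)) _.
  move=> t; rewrite mem_filter /= => /andP[ct t_in]; have [tb red] := Hts t t_in.
  by split.
have l5 : (0 < l ^ 5)%N by rewrite expn_gt0 l0.
have hLl : (l * hL + 1 <= l * hL.+1)%N by rewrite mulnS addnC leq_add2r.
(* The powers of l come from the choice of p (2), the residue of t (2, together with b) and the
   points in a class (1, in [e3]). *)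
have e1 : ((16 * (l * hL + 1) ^ 2).+1 <= 17 * (l * hL.+1) ^ 2)%N.
  have := leq_exp2r_any 2 hLl; have : (0 < (l * hL.+1) ^ 2)%N by rewrite expn_gt0 muln_gt0 l0.
  move: (_ ^ 2)%N (_ ^ 2)%N => x y; clear; lia.
have e2 : ((4 * b * (16 * (l * hL + 1) ^ 2)).+1 <= 65 * b * (l * hL.+1) ^ 2)%N.
  have := leq_exp2r_any 2 hLl; have : (0 < (l * hL.+1) ^ 2)%N by rewrite expn_gt0 muln_gt0 l0.
  move: (_ ^ 2)%N (_ ^ 2)%N => x y; clear -b0; nia.
have e3 : (3 * M0.+1 * delta_of l hW + d <= l * G)%N.
  by rewrite /delta_of /G; clear -l0; nia.
apply: (@leq_trans (d * b * l ^ 5 + 17 * (l * hL.+1) ^ 2 * (65 * b * (l * hL.+1) ^ 2) * K * (l * G))).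
  apply: leq_add; first by rewrite -mulnA leq_pmulr // muln_gt0 b0.
  by apply: leq_mul => //; apply: leq_mul => //; apply: leq_mul.
clearbody K G; move: (hL.+1) => h; apply/eq_leq; rewrite !expnMn; ring.
Qed.

End Count.

(** * Specializing several variables *)

Lemma size_fibers (T U : eqType) (h : T -> U) (s : seq T) (hs : seq U) (B : nat) :
  (forall x, x \in s -> h x \in hs) ->
  (forall u, u \in hs -> count (fun x => h x == u) s <= B)%N ->
  (size s <= size hs * B)%N.
Proof.
elim: hs s => [|u hs IH] s Hs HB.
  by case: s Hs {HB} => // x s /(_ x (mem_head _ _)).
rewrite -(count_predC (fun x => h x == u)) /= mulSn; apply: leq_add.
  by apply: HB; rewrite mem_head.
rewrite -size_filter; apply: IH => [x|v v_in].
  by rewrite mem_filter /= => /andP[xu /Hs]; rewrite inE (negbTE xu).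
apply: leq_trans (HB v _); last by rewrite inE v_in orbT.
by rewrite count_filter; apply: sub_count => x /= /andP[].
Qed.

Lemma size_height_le (ts : seq rat) b : (0 < b)%N -> uniq ts ->
  (forall t, t \in ts -> height t <= b)%N -> (size ts <= 3 * b ^ 2)%N.
Proof.
case: b => // b _ uts Hts.
pose code (t : rat) : 'I_(2 * b.+1).+1 * 'I_b.+1 := (inord `|(numq t + b.+1%:Z)%R|%N, inord `|denq t|.-1).
have inj : {in ts &, injective code}.
  move=> t t' t_in t'_in [E1 E2].
  have nt u : u \in ts -> (`|numq u| <= b.+1)%N by move=> /Hts /height_num.
  have dt u : u \in ts -> (`|denq u| <= b.+1)%N by move=> /Hts /height_den.
  have dp u : (0 < denq u) by exact: denq_gt0.
  have nE : numq t = numq t'.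
    move/(congr1 val): E1; rewrite /= !inordK ?ltnS; last 2 first.
    - by have := nt _ t'_in; clear; lia.
    - by have := nt _ t_in; clear; lia.
    by have := nt _ t'_in; have := nt _ t_in; clear; lia.
  have dE : denq t = denq t'.
    move/(congr1 val): E2; rewrite /= !inordK ?ltnS; last 2 first.
    - by have := dt _ t'_in; clear; lia.
    - by have := dt _ t_in; clear; lia.
    by have := dp t; have := dp t'; clear; lia.
  by rewrite -(divq_num_den t) nE dE divq_num_den.
have := map_inj_in_uniq inj; rewrite uts => /card_uniqP.
rewrite size_map => <-; apply: leq_trans (max_card _) _.
rewrite card_prod !card_ord; clear; nia.
Qed.

Lemma size_tail_fibers (pts : seq (seq rat)) (A B : nat) : uniq pts -> [::] \notin pts ->
  (size (undup (map (head 0%R) pts)) <= A)%N ->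
  (forall t qs, t \in map (head 0%R) pts -> uniq qs -> (forall q, q \in qs -> t :: q \in pts) -> (size qs <= B)%N) ->
  (size pts <= A * B)%N.
Proof.
move=> upts npts HA HB.
apply: leq_trans (@size_fibers _ _ (head 0%R) pts (undup (map (head 0%R) pts)) B _ _) _.
- by move=> p p_in; rewrite mem_undup map_f.
- move=> t; rewrite mem_undup => t_in; rewrite -size_filter -(size_map behead); set fib := filter _ _.
  have fibE p : p \in fib -> p = t :: behead p /\ p \in pts.
    rewrite mem_filter => /andP[/eqP ht p_in]; split=> //.
    by case: p ht p_in => [_|x s /= ->] //; rewrite (negbTE npts).
  apply: (HB t) => //.
    rewrite map_inj_in_uniq ?filter_uniq // => p p' /fibE[Ep _] /fibE[Ep' _] E.
    by rewrite Ep Ep' E.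
  by move=> q /mapP[p /fibE[Ep p_in] ->]; rewrite -Ep.
by rewrite leq_mul2r HA orbT.
Qed.

Lemma box_count (bs : seq nat) (pts : seq (seq rat)) : all (leq 1) bs -> uniq pts ->
  (forall p, p \in pts -> size p = size bs /\ forall j, (j < size bs)%N -> (height (nth 0%R p j) <= nth 0%N bs j)%N) ->
  (size pts <= \prod_(b <- bs) (3 * b ^ 2))%N.
Proof.
elim: bs pts => [|b bs IH] pts /= Hbs upts Hpts.
  rewrite big_nil; case: pts upts Hpts => [|p [|p' pts]] //= + Hpts.
  have [/size0nil-> _] := Hpts p (mem_head _ _).
  have [|/size0nil-> _] := Hpts p'; first by rewrite !inE eqxx orbT.
  by rewrite mem_head.
have /andP[b0 bs0] := Hbs; rewrite big_cons; apply: size_tail_fibers => //.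
- by apply/negP => /Hpts[].
- apply: size_height_le => //; first exact: undup_uniq.
  move=> t; rewrite mem_undup => /mapP[p p_in ->]; have [sp hp] := Hpts p p_in.
  by have := hp 0%N isT; case: (p) sp.
move=> t qs _ uqs Hqs; apply: IH => // q /Hqs/Hpts[[sq] hq].
by split=> // j jb; have := hq j.+1 jb.
Qed.

Section Scale.
Variable n : nat.

Lemma reducible_scale (c : rat) (g : {mpoly rat[n]}) : c != 0 ->
  reducible_Q (c *: g) -> reducible_Q g.
Proof.
move=> c0 [a [b [sa [sb E]]]]; exists (c^-1 *: a), b.
have c1 : c^-1 != 0 by rewrite invr_eq0.
split; first by rewrite (msizeZ _ c1).
by split=> //; rewrite -scalerAl -E scalerA mulVf // scale1r.
Qed.

Lemma reducible_unscale (c : rat) (g : {mpoly rat[n]}) : c != 0 ->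
  reducible_Q g -> reducible_Q (c *: g).
Proof.
move=> c0 red; apply: (@reducible_scale c^-1); first by rewrite invr_eq0.
by rewrite scalerA mulVf // scale1r.
Qed.

Lemma const_not_reducible (g : {mpoly rat[n]}) : (msize g <= 1)%N -> ~ reducible_Q g.
Proof.
move=> sg [a [b [sa [sb E]]]].
have a0 : a != 0 by apply: contraTneq sa => ->; rewrite msize0.
have b0 : b != 0 by apply: contraTneq sb => ->; rewrite msize0.
move: sg; rewrite E msizeM // leqNgt => /negP; apply.
by move: sa sb; move: (msize a) (msize b); clear; lia.
Qed.

Definition specs (vt : seq ('I_n * rat)) (g : {mpoly rat[n]}) : {mpoly rat[n]} :=
  foldl (fun g it => spec1 it.1 it.2 g) g vt.

Lemma specsZ vt c g : specs vt (c *: g) = c *: specs vt g.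
Proof. by elim: vt g => //= [[i t] vt] IH g; rewrite spec1Z IH. Qed.

Lemma msize_specs_le vt g : (msize (specs vt g) <= msize g)%N.
Proof.
elim: vt g => //= [[i t] vt] IH g; apply: leq_trans (IH _) _; exact: msize_spec1_le.
Qed.

Lemma spec1_monomial (i : 'I_n) (t : rat) m :
  spec1 i t 'X_[m] = t ^+ m i *: 'X_[[multinom if j == i then 0%N else m j | j < n]].
Proof.
rewrite mpolyXE_id rmorph_prod [in RHS]mpolyXE_id.
rewrite (bigD1 i) //= [in RHS](bigD1 i) //= mnmE eqxx expr0 mul1r.
rewrite rmorphXn /= spec1X eqxx -(rmorphXn (@mpolyC n rat)) mul_mpolyC; congr (_ *: _).
by apply: eq_bigr => j ji; rewrite mnmE (negbTE ji) rmorphXn /= spec1X (negbTE ji).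
Qed.

Lemma toQE (f : {mpoly int[n]}) : toQ f = map_mpoly (intr : int -> rat) f.
Proof. by []. Qed.

(** The degree bound is kept and the logarithm of the coefficients grows only by a constant factor,
    so the induction continues with l replaced by a multiple of l. *)
Lemma spec1_clear (f : {mpoly int[n]}) (i : 'I_n) (t : rat) d b l :
  (msize f <= d)%N -> (forall m, `|(f@_m)%R| <= 2 ^ l)%N -> (height t <= b)%N -> (b <= 2 ^ l)%N ->
  (0 < l)%N ->
  exists f' : {mpoly int[n]}, [/\ toQ f' = (denq t)%:~R ^+ d *: spec1 i t (toQ f),
    (msize f' <= d)%N &
    (forall m, `|(f'@_m)%R| <= 2 ^ (l * (#|{: 'X_{1..n < d}}| + 1 + d)))%N].
Proof.
move=> sf Hf tb bl l0.
pose red (m : 'X_{1..n}) := [multinom if j == i then 0%N else m j | j < n].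
pose f' : {mpoly int[n]} :=
  \sum_(m <- msupp f) (f@_m * (numq t ^+ m i * denq t ^+ (d - m i))) *: 'X_[red m].
have mi_le m : m \in msupp f -> (m i <= d)%N.
  move=> m_in; apply: leq_trans (leq_trans (ltnW (msize_mdeg_lt m_in)) sf).
  by rewrite mdegE (bigD1 i) //= leq_addr.
exists f'; split.
- have E : spec1 i t (toQ f) = \sum_(m <- msupp f) (f@_m)%:~R *: spec1 i t 'X_[m].
    rewrite toQE {1}[f]mpolyE (rmorph_sum (map_mpoly intr)) (rmorph_sum (spec1 i t)).
    by apply: eq_bigr => m _; rewrite /= map_mpolyZ map_mpolyX spec1Z.
  rewrite {}E toQE (rmorph_sum (map_mpoly intr)) scaler_sumr big_seq [RHS]big_seq.
  apply: eq_bigr => m m_in; rewrite /= map_mpolyZ map_mpolyX spec1_monomial !scalerA; congr (_ *: _).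
  by rewrite /= intrM -(rat_clear t (mi_le m m_in)); ring.
- apply: leq_trans (msize_sum _ _ _) _; apply/bigmax_leqP_seq => m m_in _.
  apply: leq_trans (msizeZ_le _ _) _; rewrite msizeX.
  apply: leq_trans (leq_trans (msize_mdeg_lt m_in) sf).
  rewrite ltnS !mdegE; apply: leq_sum => j _; rewrite mnmE; by case: ifP.
move=> m0; rewrite raddf_sum /=; apply: leq_trans (absz_sum _ _) _.
apply: (@leq_trans (\sum_(m <- msupp f) 2 ^ l * b ^ d)).
  rewrite big_seq [X in (_ <= X)%N]big_seq; apply: leq_sum => m m_in.
  rewrite mcoeffZ mcoeffX abszM -[X in (_ <= X)%N]muln1; apply: leq_mul; last by case: eqP.
  rewrite abszM; apply: leq_mul => //; rewrite abszM !abszX.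
  rewrite -[Y in (_ <= _ ^ Y)%N](subnKC (mi_le m m_in)) expnD.
  by apply: leq_mul; apply: leq_exp2r_any; [apply: height_num|apply: height_den].
rewrite big_const_seq count_predT iter_addn_0 mulnC.
have -> : (2 ^ (l * (#|{: 'X_{1..n < d}}| + 1 + d)) = 2 ^ (l * #|{: 'X_{1..n < d}}|) * (2 ^ l * (2 ^ l) ^ d))%N.
  by rewrite -expnM -!expnD; congr (_ ^ _)%N; clear; nia.
apply: leq_mul; last by rewrite leq_mul2l leq_exp2r_any ?orbT.
by apply: leq_trans (size_msupp_le sf) _; apply: const_le_exp.
Qed.

End Scale.

(* The bounds come in the order b_s, ..., b_1: the last one is not squared. *)
Fixpoint wt (bs : seq nat) : nat :=
  match bs with [::] => 0 | [:: b] => b | b :: bs' => b ^ 2 * wt bs' end.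

(** The left side is [wt bs] times the last entry, the one not squared there, and this entry is at
    most b. Thus the single unsquared bound may be moved from the largest to the smallest. *)
Lemma prod_sq_le_wt (b : nat) (bs : seq nat) : bs != [::] -> path geq b bs ->
  (\prod_(x <- bs) x ^ 2 <= b * wt bs)%N.
Proof.
elim: bs b => // c bs IH b _ /= /andP[cb pc]; rewrite big_cons.
case: bs IH pc => [|c' bs] IH pc; first by rewrite big_nil muln1 -mulnn leq_mul2r cb orbT.
rewrite [wt _]/= mulnCA leq_mul2l; apply/orP; right.
apply: leq_trans (IH c isT pc) _; by rewrite leq_mul2r cb orbT.
Qed.

Lemma spec_seq_count n (vs : seq 'I_n) d : exists C : nat,
  forall (f : {mpoly int[n]}) (l : nat) (bs : seq nat) (pts : seq (seq rat)),
    irreducible_Q (toQ f) -> (msize f <= d)%N -> (forall m, `|(f@_m)%R| <= 2 ^ l)%N -> (0 < l)%N ->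
    size bs = size vs -> all (leq 1) bs -> all (fun b => b <= 2 ^ l)%N bs -> sorted geq bs ->
    uniq pts ->
    (forall p, p \in pts -> [/\ size p = size bs,
       forall j, (j < size bs)%N -> (height (nth 0%R p j) <= nth 0%N bs j)%N &
       reducible_Q (specs (zip vs p) (toQ f))]) ->
  (size pts <= C * wt bs * l ^ 5)%N.
Proof.
elim: vs d => [|i vs IHvs] d.
  exists 0%N => f l [|//] pts [_ irr] _ _ _ _ _ _ _ _ Hpts.
  case: pts Hpts => // p pts Hpts; have [/size0nil -> _ red] := Hpts p (mem_head _ _).
  by case: irr.
have [C1 HC1] := one_variable n d; have [C2 HC2] := IHvs d.
pose card := #|{: 'X_{1..n < d}}|; pose kap := (card + 1 + d)%N.
exists (C1 * 3 ^ size vs + 3 * C2 * kap.+1 ^ 5)%N => f l [//|b bs] pts irr sf Hf l0 [sbs] /= /andP[b0 bs0] /andP[bl bsl] srt upts Hpts.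
have heads t : t \in map (head 0%R) pts -> (height t <= b)%N.
  move=> /mapP[p p_in ->]; have [sp hp _] := Hpts p p_in; have := hp 0%N isT.
  by case: (p) sp.
have npts : [::] \notin pts by apply/negP => /Hpts[].
have [bad Hbad] : exists bad : rat -> bool, forall t, t \in map (head 0%R) pts ->
    (bad t <-> reducible_Q (spec1 i t (toQ f))).
  apply: (@seq_choice _ _ _ (fun t (c : bool) => c <-> _) false) => t _.
  by case: (classic (reducible_Q (spec1 i t (toQ f)))) => H; [exists true|exists false].
rewrite -(count_predC (fun p => bad (head 0%R p))) -!size_filter.
set pb := filter _ _; set pg := filter _ _.
have sub_b p : p \in pb -> p \in pts by rewrite mem_filter => /andP[].
have sub_g p : p \in pg -> p \in pts by rewrite mem_filter => /andP[].
(* Few bad heads, by the case of one variable; their tails are bounded only by the size of the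
   box. *)
have le_b : (size pb <= C1 * b * l ^ 5 * \prod_(x <- bs) (3 * x ^ 2))%N.
  apply: size_tail_fibers; first exact: filter_uniq.
  - by apply/negP => /sub_b; rewrite (negbTE npts).
  - apply: (HC1 f i l b) => //; first exact: undup_uniq.
    move=> t; rewrite mem_undup => /mapP[p]; rewrite mem_filter => /andP[bp p_in] ->.
    have h_in : head 0%R p \in map (head 0%R) pts by apply: map_f.
    by split; [exact: heads|apply/Hbad].
  move=> t qs _ uqs Hqs; apply: box_count => // q /Hqs/sub_b/Hpts[[sq] hq _].
  by split=> // j jb; have := hq j.+1 jb.
(* All heads are allowed here; for each of them the specialized polynomial is irreducible and the
   induction bounds the tails. *)
have le_g : (size pg <= 3 * b ^ 2 * (C2 * wt bs * (l * kap.+1) ^ 5))%N.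
  apply: size_tail_fibers; first exact: filter_uniq.
  - by apply/negP => /sub_g; rewrite (negbTE npts).
  - apply: size_height_le => //; first exact: undup_uniq.
    by move=> t; rewrite mem_undup => /mapP[p /sub_g p_in ->]; apply/heads/map_f.
  move=> t qs /mapP[p]; rewrite mem_filter /= => /andP[gp p_in] Et uqs Hqs.
  have t_in : t \in map (head 0%R) pts by rewrite Et map_f.
  have nred : ~ reducible_Q (spec1 i t (toQ f)).
    by move=> /(Hbad t t_in); rewrite Et; apply/negP.
  case: qs uqs Hqs => [//|q0 qs0]; set qs := q0 :: qs0 => uqs Hqs.
  (* Irreducibility includes being nonconstant. A constant would stay constant under the remaining
     specializations, hence not be reducible, while at least one tail exists. *)
  have g1 : (1 < msize (spec1 i t (toQ f)))%N.
    rewrite ltnNge; apply/negP => gle.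
    have [_ _] := Hpts _ (sub_g _ (Hqs q0 (mem_head _ _))); rewrite /= => /const_not_reducible; apply.
    by apply: leq_trans gle; apply: msize_specs_le.
  have [f' [Ef' sf' Hf']] := spec1_clear i sf Hf (heads t t_in) bl l0.
  have yd0 : (denq t)%:~R ^+ d != 0 :> rat by rewrite expf_neq0 // denq_neq0Q.
  apply: (HC2 f') => //.
  - by split; rewrite Ef' ?(msizeZ _ yd0) // => /(reducible_scale yd0).
  - move=> m; apply: leq_trans (Hf' m) _; rewrite leq_pexp2l // -/card -/kap.
    by rewrite leq_mul2l leqnSn orbT.
  - by rewrite muln_gt0 l0.
  - apply/allP => x /(allP bsl) xl; apply: leq_trans xl _; rewrite leq_pexp2l //.
    by rewrite leq_pmulr.
  - exact: path_sorted srt.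
  move=> q /Hqs/sub_g/Hpts[[sq] hq red]; split=> //.
    by move=> j jb; have := hq j.+1 jb.
  by rewrite Ef' specsZ; apply: reducible_unscale.
have prod_le : (\prod_(x <- bs) (3 * x ^ 2) * b <= 3 ^ size vs * wt (b :: bs))%N.
  have -> : (\prod_(x <- bs) (3 * x ^ 2) = 3 ^ size vs * \prod_(x <- bs) x ^ 2)%N.
    by rewrite -sbs big_split /= prod_seq_const.
  rewrite -mulnA leq_mul2l; apply/orP; right.
  case: (bs) srt => [|x bs'] srt; first by rewrite big_nil mul1n.
  by rewrite [wt _]/= -mulnn mulnC -mulnA leq_mul2l prod_sq_le_wt ?orbT.
have wt_le : (b ^ 2 * wt bs <= wt (b :: bs))%N by case: (bs) => //=; rewrite muln0.
have -> : ((C1 * 3 ^ size vs + 3 * C2 * kap.+1 ^ 5) * wt (b :: bs) * l ^ 5 =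
  C1 * l ^ 5 * (3 ^ size vs * wt (b :: bs)) + 3 * C2 * (l * kap.+1) ^ 5 * wt (b :: bs))%N.
  by rewrite expnMn; move: (wt _) (l ^ 5)%N (3 ^ _)%N (_ ^ 5)%N => w x y z; ring.
apply: leq_add.
  apply: leq_trans le_b _.
  have -> : (C1 * b * l ^ 5 * \prod_(x <- bs) (3 * x ^ 2) =
      C1 * l ^ 5 * (\prod_(x <- bs) (3 * x ^ 2) * b))%N.
    by move: (\prod_(x <- bs) _)%N (l ^ 5)%N => w x; ring.
  by rewrite leq_mul2l prod_le orbT.
apply: leq_trans le_g _.
have -> : (3 * b ^ 2 * (C2 * wt bs * (l * kap.+1) ^ 5) = 3 * C2 * (l * kap.+1) ^ 5 * (b ^ 2 * wt bs))%N.
  by move: (wt _) (b ^ 2)%N ((l * _) ^ 5)%N => w x y; ring.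
by rewrite leq_mul2l wt_le orbT.
Qed.

Lemma leq_coef_polynorm n (f : intpoly n) m : (`|(f@_m)%R| <= polynorm f)%N.
Proof.
rewrite /polynorm leq_max; apply/orP; right.
have [m_in|/memN_msupp_eq0->] := boolP (m \in msupp f); last by rewrite absz0.
exact: (@leq_bigmax_seq _ (msupp f) xpredT (fun m => `|(f@_m)%R|%N)).
Qed.

Section SpecsMorphism.
Variables (n : nat) (vt : seq ('I_n * rat)).

Lemma specs_is_additive : additive (@specs n vt).
Proof. by elim: vt => //= [[i t] vt'] IH a b /=; rewrite rmorphB IH. Qed.

HB.instance Definition _ := GRing.isAdditive.Build _ _ (@specs n vt) specs_is_additive.

Lemma specs_is_multiplicative : multiplicative (@specs n vt).
Proof.
elim: vt => //= [[i t] vt'] [IHM IH1]; split => [a b|] /=; first by rewrite rmorphM IHM.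
by rewrite rmorph1 IH1.
Qed.

HB.instance Definition _ := GRing.isMultiplicative.Build _ _ (@specs n vt) specs_is_multiplicative.
End SpecsMorphism.

Lemma specsC n (vt : seq ('I_n * rat)) c : specs vt c%:MP = c%:MP.
Proof. by elim: vt => //= [[i t] vt] IH; rewrite spec1C. Qed.

Lemma specsX n (vt : seq ('I_n * rat)) j :
  specs vt 'X_j = if j \in unzip1 vt then (nth 0 (unzip2 vt) (index j (unzip1 vt)))%:MP else 'X_j.
Proof.
elim: vt => //= [[i t] vt] IH; rewrite spec1X inE /= [i == j]eq_sym.
by case: eqP => _ /=; [rewrite specsC|rewrite IH].
Qed.

(** * From iterated specialization to Q[Y] *)

Section Link.
Variables (s r : nat).

(** Reversed, so that the variable with the largest bound is specialized first. *)
Definition tvars : seq 'I_(s + r) := map (@lshift s r) (rev (enum 'I_s)).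
Definition tvals (t : point s) : seq rat := map t (rev (enum 'I_s)).

Definition emb : {mpoly rat[r]} -> {mpoly rat[s + r]} :=
  comp_mpoly [tuple 'X_(@rshift s r j) | j < r].
HB.instance Definition _ := GRing.RMorphism.on emb.

(** A left inverse of [emb], which shows that [emb] keeps polynomials nonconstant. *)
Definition retr : {mpoly rat[s + r]} -> {mpoly rat[r]} :=
  comp_mpoly [tuple (match split j with inl _ => 0 | inr k => 'X_k end) | j < s + r].
HB.instance Definition _ := GRing.RMorphism.on retr.

Lemma embK g : retr (emb g) = g.
Proof.
apply: (@mpoly_rmorph_eq _ _ _ (retr \o emb) idfun) => [c|j] /=.
  by rewrite /emb /retr !comp_mpolyC.
rewrite /emb comp_mpolyXU -tnth_nth tnth_mktuple /retr comp_mpolyXU -tnth_nth tnth_mktuple.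
by rewrite (unsplitK (inr _)).
Qed.

Lemma msize_emb_gt1 g : (1 < msize g)%N -> (1 < msize (emb g))%N.
Proof.
rewrite !ltnNge; apply: contra => H; rewrite -(embK g) (msize1_polyC H) /retr comp_mpolyC msizeC.
by case: eqP.
Qed.

Lemma emb_specialize f t : emb (specialize f t) = specs (zip tvars (tvals t)) (toQ f).
Proof.
have sz : size tvars = size (tvals t) by rewrite !size_map.
rewrite /specialize; set lq := [tuple _ | _ < _].
apply: (@mpoly_rmorph_eq _ _ _ (emb \o comp_mpoly lq) (@specs _ (zip tvars (tvals t)))) => [c|j] /=.
  by rewrite comp_mpolyC specsC /emb comp_mpolyC.
rewrite specsX unzip1_zip ?sz // unzip2_zip ?sz //.
rewrite comp_mpolyXU -tnth_nth tnth_mktuple.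
case: splitP => k Ej.
  have -> : j = lshift r k by apply: val_inj.
  have k_in : k \in rev (enum 'I_s) by rewrite mem_rev mem_enum.
  rewrite /emb comp_mpolyC map_f // index_map; last exact: lshift_inj.
  by rewrite (nth_map k) ?index_mem // nth_index.
have -> : j = rshift s k by apply: val_inj.
rewrite /emb comp_mpolyXU -tnth_nth tnth_mktuple.
case: ifP => // /mapP[k' _ /eqP]; by rewrite eq_rlshift.
Qed.

Lemma spec_reducible_specs f t : spec_reducible f t ->
  reducible_Q (specs (zip tvars (tvals t)) (toQ f)).
Proof.
move=> [a [b [sa [sb E]]]]; exists (emb a), (emb b).
by rewrite !msize_emb_gt1 // -emb_specialize E rmorphM.
Qed.

Lemma tvals_inj : injective tvals.
Proof.
move=> t t' /eq_in_map E; apply/ffunP => k; apply: E.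
by rewrite mem_rev mem_enum.
Qed.

Lemma wt_rcons (bs : seq nat) x : wt (rcons bs x) = (x * \prod_(y <- bs) y ^ 2)%N.
Proof.
elim: bs => [|b bs IH]; first by rewrite big_nil muln1.
rewrite rcons_cons big_cons mulnCA -IH /=.
by case: bs {IH}.
Qed.

Lemma specialization_count d : exists C : nat,
  forall (f : intpoly (s + r)) (l : nat) (b : nat -> nat) (ts : seq (point s)),
    irreducible_over_Q f -> (msize f <= d)%N -> (forall m, `|(f@_m)%R| <= 2 ^ l)%N -> (0 < l)%N ->
    (forall j, j < s -> 0 < b j.+1 <= 2 ^ l)%N ->
    (forall j, j.+1 < s -> b j.+1 <= b j.+2)%N -> uniq ts ->
    (forall t, t \in ts -> (forall j : 'I_s, height (t j) <= b j.+1)%N /\ spec_reducible f t) ->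
  (size ts <= C * (b 1 * \prod_(y <- map b (iota 2 (s - 1))) y ^ 2) * l ^ 5)%N.
Proof.
have [C HC] := spec_seq_count tvars d; exists C => f l b ts irr sf Hf l0 Hb mono uts Hts.
pose bs := rev (map b (iota 1 s)).
have sbs : size bs = s by rewrite size_rev size_map size_iota.
have szv : size tvars = s by rewrite size_map size_rev -cardE card_ord.
have wtE : (wt bs <= b 1 * \prod_(y <- map b (iota 2 (s - 1))) y ^ 2)%N.
  rewrite /bs; case: (s) => [|s'] //=.
  by rewrite rev_cons wt_rcons subn1 /= (perm_big _ (permEl (perm_rev _))).
apply: (@leq_trans (C * wt bs * l ^ 5)); last by rewrite leq_mul2r leq_mul2l wtE !orbT.
rewrite -(size_map tvals); apply: (HC f l bs) => //.
- by rewrite sbs szv.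
- by rewrite all_rev all_map; apply/allP => k; rewrite mem_iota /= => /andP[k0 ks]; case: k k0 ks => // k _ ks; have /andP[] := Hb k ks.
- by rewrite all_rev all_map; apply/allP => k; rewrite mem_iota /= => /andP[k0 ks]; case: k k0 ks => // k _ ks; have /andP[] := Hb k ks.
- rewrite /bs rev_sorted.
  apply/(sortedP 0%N) => j; rewrite size_map size_iota => js.
  by rewrite !(nth_map 0%N) ?size_iota // ?(ltnW js) // !nth_iota // ?(ltnW js) // !add1n; apply: mono.
- by rewrite map_inj_uniq //; apply: tvals_inj.
move=> p /mapP[t t_in ->]; have [ht red] := Hts t t_in; split.
- by rewrite sbs size_map size_rev -cardE card_ord.
- move=> j; rewrite sbs => js.
  (* Position j of the reversed list belongs to the coordinate s - j - 1, counted from 0. *)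
  have ok : (s - j.+1 < s)%N by rewrite ltn_subrL (leq_trans _ js).
  pose k := Ordinal ok.
  have -> : nth 0 (tvals t) j = t k.
    rewrite (nth_map k) ?size_rev -?cardE ?card_ord // nth_rev -?cardE ?card_ord //.
    by congr (t _); apply: val_inj; rewrite /= nth_enum_ord.
  have -> : nth 0%N bs j = b k.+1.
    rewrite /bs nth_rev ?size_map ?size_iota // (nth_map 0%N) ?size_iota // nth_iota //.
  exact: ht.
exact: spec_reducible_specs.
Qed.

End Link.

End HilbertIrreducibility.

From Stdlib Require Import Reals Lra Lia ZArith.
Open Scope R_scope.

(** * Passage from integer to real bounds *)

Module RealBounds.

Lemma nat_floor_exists (x : R) : 0 <= x -> exists n : nat, INR n <= x < INR n + 1.
Proof.
move=> x0; have [H1 H2] := base_Int_part x.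
have z0 : (0 <= Int_part x)%Z by apply: le_IZR; apply: Rnot_lt_le => H; have : IZR (Int_part x) <= -1; [apply: IZR_le; have := lt_IZR _ _ H; lia|lra].
exists (Z.to_nat (Int_part x)); rewrite INR_IZR_INZ Z2Nat.id //; lra.
Qed.

Lemma INR_leq (m n : nat) : leq m n -> INR m <= INR n.
Proof. by move/leP; apply: le_INR. Qed.

Lemma INR_muln (m n : nat) : INR (muln m n) = INR m * INR n.
Proof. by rewrite -mult_INR. Qed.

Lemma INR_expn (m k : nat) : INR (expn m k) = INR m ^ k.
Proof. by elim: k => // k IH; rewrite expnS INR_muln IH. Qed.

Lemma INR_prod_sq_le (b : nat -> nat) (B : nat -> R) (ks : seq nat) :
  (forall k, k \in ks -> INR (b k) <= B k) ->
  INR (\prod_(y <- map b ks) expn y 2) <= foldr Rmult 1 (map (fun i => (B i) ^ 2) ks).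
Proof.
elim: ks => [|k ks IH] H; first by rewrite big_nil /=; lra.
rewrite /= big_cons INR_muln INR_expn; apply: Rmult_le_compat.
- by apply: pow_le; apply: pos_INR.
- exact: pos_INR.
- by apply: pow_incr; split; [apply: pos_INR|apply: H; rewrite mem_head].
by apply: IH => j jk; apply: H; rewrite inE jk orbT.
Qed.

Lemma trunc_log_ln (n : nat) : leq 1 n -> INR (trunc_log 2 n) * ln 2 <= ln (INR n).
Proof.
move=> n0; rewrite -ln_pow; last lra.
have H := INR_leq _ _ (trunc_logP (ltnSn 1) n0).
rewrite INR_expn in H.
have p0 : 0 < INR 2 ^ trunc_log 2 n by apply: pow_lt; apply: lt_0_INR; lia.
case: (Rle_lt_or_eq_dec _ _ H) => [lt|->]; last exact: Rle_refl.
by apply: Rlt_le; apply: ln_increasing.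
Qed.

Lemma leq_of_INR (m n : nat) : INR m < INR n + 1 -> leq m n.
Proof. by rewrite -S_INR => /INR_lt ?; apply/leP; lia. Qed.

Lemma chain_le (B : nat -> R) (s : nat) :
  (forall i : nat, leq 1 i -> leq i.+1 s -> B i <= B i.+1) ->
  forall i j, leq 1 i -> leq i j -> leq j s -> B i <= B j.
Proof.
move=> mono i j i1; elim: j => [|j IH] ij js; first by move: (leq_trans i1 ij).
move: ij; rewrite leq_eqVlt => /orP[/eqP->|ij]; first exact: Rle_refl.
by apply: Rle_trans (IH ij (ltnW js)) _; apply: mono => //; exact: leq_trans i1 ij.
Qed.
End RealBounds.
Import RealBounds.

(* S(f,B_1,...,B_s) <= C * B_1 * prod_{i=2}^s B_i^2 * (log||f|| + log B_s)^5,
   stated as: every duplicate-free list of points t in Q^s with H(t_i) <= B_i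
   and f(t,Y) reducible has length at most the bound.  B_i is B i (i = 1..s);
   the coordinate t_(j+1) is t j for j : 'I_s. *)
Theorem theorem1p6 (d r s : nat) :
  (1 <= r)%nat -> (1 <= s)%nat ->
  exists C : R, 0 < C /\
  forall (f : intpoly (s + r)) (B : nat -> R),
    irreducible_over_Q f ->
    total_degree f = d ->
    1 <= B 1%nat ->
    (forall i : nat, (1 <= i)%nat -> (i < s)%nat -> B i <= B i.+1) ->
    forall ts : seq (point s),
      uniq ts ->
      (forall t, t \in ts ->
         (forall j : 'I_s, INR (height (t j)) <= B (j.+1)) /\ spec_reducible f t) ->
      INR (size ts) <=
        C * B 1%nat * foldr Rmult 1 (map (fun i => (B i) ^ 2) (iota 2 (s - 1)))
          * (ln (INR (polynorm f)) + ln (B s)) ^ 5.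
Proof.
move=> _ s1; have [C HC] := HilbertIrreducibility.specialization_count s r d.+1.
(* The summand 1 makes the constant positive; 6 comes from l <= 6 (log|f| + log B_s). *)
exists ((INR C + 1) * 6 ^ 5); split.
  by have := pos_INR C => ?; apply: Rmult_lt_0_compat; [lra|apply: pow_lt; lra].
move=> f B irr degf B1 mono ts uts Hts.
have Bge1 j : leq j.+1 s -> 1 <= B j.+1.
  elim: j => [//|j IH] js; apply: Rle_trans (IH (ltnW js)) _; exact: mono.
(* Heights are integers, so each B_k may be replaced by its integer part. *)
have [b Hb] : exists b : nat -> nat, forall k, k \in iota 1 s -> INR (b k) <= B k < INR (b k) + 1.
  apply: (@HilbertIrreducibility.seq_choice _ _ (iota 1 s) (fun k n => INR n <= B k < INR n + 1) 0%nat) => k; rewrite mem_iota add1n ltnS => /andP[k0 ks].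
  by apply: nat_floor_exists; case: k k0 ks => // k _ ks; have := Bge1 k ks; lra.
have bk k : leq 1 k -> leq k s -> INR (b k) <= B k < INR (b k) + 1.
  by move=> k1 ks; apply: Hb; rewrite mem_iota add1n ltnS k1 ks.
have Bs : forall k, leq 1 k -> leq k s -> B k <= B s.
  by move=> k k1 ks; apply: (chain_le B s).
set P := polynorm f; pose l := addn (trunc_log 2 P).+1 (trunc_log 2 (b s)).+1.
have P2 : leq 2 P by rewrite /P /polynorm leq_maxl.
have Pl : leq P (expn 2 l).
  by apply: leq_trans (ltnW (trunc_log_ltn P (ltnSn 1))) _; rewrite leq_exp2l // leq_addr.
have bsl : leq (b s) (expn 2 l).
  by apply: leq_trans (ltnW (trunc_log_ltn (b s) (ltnSn 1))) _; rewrite leq_exp2l // leq_addl.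
have bs1 k : leq 1 k -> leq k s -> leq 1 (b k).
  move=> k1 ks; apply: leq_of_INR; have := bk k k1 ks; case: k k1 ks => // k _ ks.
  by have := Bge1 k ks; rewrite /=; lra.
have H : leq (size ts) (muln (muln C (muln (b 1%nat) (\prod_(y <- map b (iota 2 (s - 1))) expn y 2))) (expn l 5)).
  apply: HC irr _ _ _ _ _ uts _.
  - by rewrite -degf /total_degree leqSpred.
  - by move=> m; apply: leq_trans Pl; apply: HilbertIrreducibility.leq_coef_polynorm.
  - by rewrite /l addSn.
  - move=> j js; rewrite (bs1 j.+1) //=; apply: leq_trans bsl; apply: leq_of_INR.
    have := bk j.+1 isT js; have := bk s s1 (leqnn s); have := Bs j.+1 isT js; lra.
  - move=> j js; apply: leq_of_INR.
    have := bk j.+1 isT (ltnW js); have := bk j.+2 isT js; have := mono j.+1 isT js; lra.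
  move=> t t_in; have [ht red] := Hts t t_in; split=> // j; apply: leq_of_INR.
  have := bk j.+1 isT (ltn_ord j); have := ht j; lra.
apply: Rle_trans (INR_leq _ _ H) _; rewrite INR_muln INR_expn INR_muln INR_muln.
have HB : INR (\prod_(y <- map b (iota 2 (s - 1))) expn y 2) <=
    foldr Rmult 1 (map (fun i => (B i) ^ 2) (iota 2 (s - 1))).
  apply: INR_prod_sq_le => k; rewrite mem_iota => /andP[k2 ks].
  by have [] := bk k (ltnW k2); rewrite // -ltnS; move: ks; rewrite addnBA // addKn.
set F := foldr _ _ _ in HB *; set Q := INR (bigop _ _ _) in HB *.
have Q0 : 0 <= Q by apply: pos_INR.
have b1 : INR (b 1%nat) <= B 1%nat by have := bk 1%nat isT s1; lra.
have b10 : 0 <= INR (b 1%nat) by apply: pos_INR.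
(* As ln 2 > 1/2, each binary logarithm is at most twice the natural one, and the two added units
   are at most 4 ln 2 <= 4 ln P because P >= 2. *)
have l6 : INR l <= 6 * (ln (INR P) + ln (B s)).
  have L2 := ln_lt_2.
  have lnP := trunc_log_ln P (ltnW P2); have lnb := trunc_log_ln (b s) (bs1 s s1 (leqnn s)).
  have lnbB : ln (INR (b s)) <= ln (B s).
    have bs0 : 0 < INR (b s) by apply: lt_0_INR; apply/leP; apply: bs1.
    have [[lt|->] _] := bk s s1 (leqnn s); last exact: Rle_refl.
    by apply: Rlt_le; apply: ln_increasing.
  have lnP2 : ln 2 <= ln (INR P).
    have := INR_leq _ _ P2; rewrite [INR 2]/= => -[lt|<-]; last exact: Rle_refl.
    by apply: Rlt_le; apply: ln_increasing; lra.
  have lnB0 : 0 <= ln (B s).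
    rewrite -ln_1; have := Bge1 s.-1; rewrite prednK // => /(_ (leqnn s)) [lt|<-]; last exact: Rle_refl.
    by apply: Rlt_le; apply: ln_increasing; lra.
  rewrite /l -plusE plus_INR !S_INR.
  have := pos_INR (trunc_log 2 P); have := pos_INR (trunc_log 2 (b s)); nra.
have l0 : 0 <= INR l by apply: pos_INR.
have C0 := pos_INR C.
have H1 : INR l ^ 5 <= 6 ^ 5 * (ln (INR P) + ln (B s)) ^ 5.
  by rewrite -Rpow_mult_distr; apply: pow_incr.
have H2 : INR C * (INR (b 1%nat) * Q) <= (INR C + 1) * (B 1%nat * F).
  apply: Rmult_le_compat => //; [exact: Rmult_le_pos|lra|exact: Rmult_le_compat].
have H3 : 0 <= INR C * (INR (b 1%nat) * Q) by apply: Rmult_le_pos => //; apply: Rmult_le_pos.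
have H4 : 0 <= INR l ^ 5 by apply: pow_le.
apply: Rle_trans (Rmult_le_compat _ _ _ _ H3 H4 H2 H1) _; apply: Req_le; ring.
Qed.
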